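(* Let $\sigma:\mathbb R\to\operatorname{Aut}\mathcal T(\mathbb N^\times\ltimes\mathbb N)$ be the dynamics such that $\sigma_t(S)=S$ and $\sigma_t(V_a)=a^{it}V_a$ for $t\in\mathbb R$, $a\in\mathbb N^\times$, and let $\beta\in\mathbb R$. Then every KMS$_\beta$ state of $(\mathcal T(\mathbb N^\times\ltimes\mathbb N),\sigma)$ factors through a state of the additive boundary quotient $\partial_{\rm add}\mathcal T(\mathbb N^\times\ltimes\mathbb N)$.
   Context: $\mathbb N=\{0,1,2,\dots\}$ and $\mathbb N^\times=\{1,2,3,\dots\}$ (under multiplication). $\mathbb N^\times\ltimes\mathbb N$ is the semigroup of pairs $(a,m)$, $a\in\mathbb N^\times$, $m\in\mathbb N$, with product $(a,m)(b,n)=(ab,bm+n)$. On $\ell^2(\mathbb N^\times\ltimes\mathbb N)$ with its usual orthonormal basis $\{\varepsilon_{(b,n)}\}$, $T_{(a,m)}$ is the isometry $T_{(a,m)}\varepsilon_{(b,n)}=\varepsilon_{(ab,bm+n)}$, and $\mathcal T(\mathbb N^\times\ltimes\mathbb N)$ is the $C^*$-algebra generated by $\{T_{(a,m)}\}$. Write $S:=T_{(1,1)}$ and $V_a:=T_{(a,0)}$. The additive boundary quotient $\partial_{\rm add}\mathcal T(\mathbb N^\times\ltimes\mathbb N)$ is the quotient of $\mathcal T(\mathbb N^\times\ltimes\mathbb N)$ by the closed ideal generated by $1-SS^*$. The elements $V_aS^mS^{*n}V_b^*$ span a dense $*$-subalgebra and are $\sigma$-analytic, with $\sigma_z(V_aS^mS^{*n}V_b^*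 )=(ab^{-1})^{iz}V_aS^mS^{*n}V_b^*$. A state $\phi$ is a KMS$_\beta$ state if $\phi(xy)=\phi(y\sigma_{i\beta}(x))$ for all $x,y$ in a $\sigma$-invariant dense set of analytic elements (and, for $\beta=0$, $\phi$ is a $\sigma$-invariant trace). *)

(* Defs.v *)
From HB Require Import structures.
From mathcomp Require Import all_boot all_order all_algebra finmap.
From mathcomp Require Import all_classical all_reals all_analysis.
From mathcomp Require Import complex.
From mathcomp.analysis.showcase Require Import summability.
From mathcomp Require Import ring lra.
Set Implicit Arguments. Unset Strict Implicit. Unset Printing Implicit Defensive.
Import Order.TTheory GRing.Theory Num.Theory.
Import numFieldNormedType.Exports.
Local Open Scope classical_set_scope.
Local Open Scope ring_scope.
Local Open Scope complex_scope.

#[global] Instance totally_proper (I : choiceType) : ProperFilter (@totally I).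
Proof.
eapply filter_from_proper; last by move=> A _; exists A; rewrite /= fsubset_refl.
apply: filter_fromT_filter; first by exists fset0.
by move=> A B /=; exists (A `|` B)%fset => P /=; rewrite fsubUset => /andP[].
Qed.

Section Sums.
Variables (R : realType) (I : choiceType).
Local Notation C := R[i].
Implicit Types (A : {fset I}).

Lemma partial_sumE (V : zmodType) (x : I -> V) A :
  partial_sum x A = \sum_(i <- A) x i.
Proof. by rewrite big_seq_fsetE. Qed.

Lemma le_psum (b : I -> R) A B : (forall i, 0 <= b i) -> (A `<=` B)%fset ->
  partial_sum b A <= partial_sum b B.
Proof.
move=> b0 AB; rewrite !partial_sumE (big_fsetID _ (mem A) B) /=.
have -> : [fset x in B | x \in A]%fset = A.
  apply/fsetP => x; rewrite !inE /=; apply/andP/idP => [[]//|xA]; split=> //.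
  exact: (fsubsetP AB).
by rewrite lerDl sumr_ge0.
Qed.

Lemma psum_le_esum (b : I -> R) A : (forall i, 0 <= b i) ->
  ((partial_sum b A)%:E <= \esum_(i in [set: I]) (b i)%:E)%E.
Proof.
move=> b0; apply: esum_ge; exists [set` A]; first by split.
by rewrite partial_sumE -sumEFin fsbig_seq.
Qed.

Lemma esum_le_psum (b : I -> R) (M : \bar R) :
  (forall A, (partial_sum b A)%:E <= M)%E ->
  (\esum_(i in [set: I]) (b i)%:E <= M)%E.
Proof.
move=> bM; apply: ge_ereal_sup => _ [X [finX _] <-].
by rewrite fsbig_finite//= sumEFin -partial_sumE.
Qed.

Lemma cvg_psum_ge0 (b : I -> R) (M : R) : (forall i, 0 <= b i) ->
  (forall A, partial_sum b A <= M) ->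
  partial_sum b @ totally --> sup (range (partial_sum b)).
Proof.
move=> b0 bM.
have hs : has_sup (range (partial_sum b)).
  split; first by exists (partial_sum b fset0), fset0.
  by exists M => _ [A _ <-].
apply/cvgrPdist_lt => e e0.
have [_ [A _ <-] HA] := sup_adherent e0 hs.
exists A => //= B AB.
have h1 := le_psum b0 AB.
have h2 : partial_sum b B <= sup (range (partial_sum b)).
  by apply: ub_le_sup; [case: hs|exists B].
by rewrite ger0_norm ?subr_ge0//; lra.
Qed.

Lemma cvg_psum_abs (b g : I -> R) (M : R) : (forall i, `|g i| <= b i) ->
  (forall A, partial_sum b A <= M) ->
  cvg (partial_sum g @ totally).
Proof.
move=> gb bM.
have b0 i : 0 <= b i by apply: le_trans (gb i); exact: normr_ge0.
have c1 := cvg_psum_ge0 b0 bM.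
have h0 i : 0 <= g i + b i.
  by have := gb i; rewrite ler_norml => /andP[]; lra.
have c2 : partial_sum (fun i => g i + b i) @ totally -->
   sup (range (partial_sum (fun i => g i + b i))).
  apply: (@cvg_psum_ge0 _ (M + M)) => // A.
  rewrite partial_sumE big_split/= lerD// -?partial_sumE//.
  apply: le_trans (bM A); rewrite !partial_sumE; apply: ler_sum => i _.
  by apply: le_trans (gb i); exact: ler_norm.
have -> : partial_sum g = partial_sum (fun i => g i + b i) \- partial_sum b.
  by apply/funext => A /=; rewrite !partial_sumE big_split/= addrK.
by apply/cvg_ex; eexists; apply: cvgB c2 c1.
Qed.

Lemma cvgC (T : Type) (F : set_system T) (FF : Filter F) (f : T -> R) (l : R) :
  f @ F --> l -> (fun x => (f x)%:C : C^o) @ F --> (l%:C : C^o).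
Proof.
move=> fl; apply/cvgrPdist_lt => -[e e'].
rewrite ltcE /= => /andP[/eqP -> e0].
move/cvgrPdist_lt : fl => /(_ _ e0); apply: filterS => x.
by rewrite -rmorphB/= normc_def/= expr0n/= addr0 sqrtr_sqr ltcR.
Qed.

Lemma cvg_psum_C (b : I -> R) (w : I -> C) (M : R) :
  (forall i, `|w i| <= (b i)%:C) ->
  (forall A, partial_sum b A <= M) ->
  cvg (partial_sum (w : I -> C^o) @ totally).
Proof.
move=> wb bM.
have hRe i : `|complex.Re (w i)| <= b i.
  by rewrite -lecR; apply: le_trans (wb i); exact: normc_ge_Re.
have hIm i : `|complex.Im (w i)| <= b i.
  rewrite -lecR; apply: le_trans (wb i).
  by rewrite normc_def lecR -sqrtr_sqr ler_sqrt ?lerDr ?addr_ge0 ?sqr_ge0.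
have [l1 c1] := (cvg_ex _).1 (cvg_psum_abs hRe bM).
have [l2 c2] := (cvg_ex _).1 (cvg_psum_abs hIm bM).
apply/cvg_ex; exists ((l1%:C + 'i * l2%:C) : C^o).
have -> : partial_sum (w : I -> C^o) =
   (fun A => ((partial_sum (fun i => complex.Re (w i)) A)%:C : C^o)) \+
   (fun A => 'i *: ((partial_sum (fun i => complex.Im (w i)) A)%:C : C^o)).
  apply/funext => A /=; rewrite !partial_sumE !rmorph_sum /= scaler_sumr -big_split/=.
  by apply: eq_bigr => i _; rewrite {1}[w i]complexE.
by apply: cvgD; [exact: cvgC c1|apply: cvgZr; exact: cvgC c2].
Qed.

End Sums.

(* Norms over R[i] take their values in R[i]; rnorm is the same norm as a real. *)
Definition rnorm (R : realType) (V : normedZmodType R[i]) (x : V) : R :=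
  complex.Re `|x|.

Section RNorm.
Variables (R : realType) (V : normedZmodType R[i]).
Implicit Types x y : V.

Lemma rnormE x : `|x| = (rnorm x)%:C.
Proof. by rewrite /rnorm RRe_real// ger0_real. Qed.

Lemma rnorm_ge0 x : 0 <= rnorm x.
Proof. by rewrite -ler0c -rnormE. Qed.

Lemma rnormD x y : rnorm (x + y) <= rnorm x + rnorm y.
Proof. by rewrite -lecR rmorphD/= -!rnormE ler_normD. Qed.

Lemma rnorm_eq0 x : rnorm x = 0 -> x = 0.
Proof. by move=> h; apply/normr0_eq0; rewrite rnormE h. Qed.

Lemma rnorm0 : rnorm (0 : V) = 0.
Proof. by rewrite /rnorm normr0. Qed.

End RNorm.

Lemma rnormM (R : realType) (x y : R[i]) : rnorm (x * y) = rnorm x * rnorm y.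
Proof. by apply: complexI; rewrite rmorphM/= -!rnormE normrM. Qed.

Lemma rnormC (R : realType) (x : R) : rnorm (x%:C : R[i]) = `|x|.
Proof. by rewrite /rnorm normc_def/= expr0n addr0 sqrtr_sqr. Qed.

Lemma rnorm_conj (R : realType) (x : R[i]) : rnorm (x^*%C) = rnorm x.
Proof. by rewrite /rnorm normcJ. Qed.

Lemma eq_cvg_to (T : Type) (U : topologicalType) (F : set_system T)
  (f g : T -> U) (l : U) : (forall x, f x = g x) -> f @ F --> l -> g @ F --> l.
Proof. by move=> /funext ->. Qed.

Section Ell2.
Variables (R : realType) (I : choiceType).
Local Notation C := R[i].

Definition square_summable : {pred I -> C} :=
  fun u => (\esum_(i in [set: I]) (rnorm (u i) ^+ 2)%:E < +oo)%E.

Lemma square_summableP (u : I -> C) :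
  reflect (exists M, forall A, partial_sum (fun i => rnorm (u i) ^+ 2) A <= M)
          (u \in square_summable).
Proof.
have u0 i : 0 <= rnorm (u i) ^+ 2 by exact: sqr_ge0.
apply: (iffP idP) => [|[M uM]]; rewrite unfold_in; last first.
  by apply: (@le_lt_trans _ _ M%:E); rewrite ?ltry//; apply: esum_le_psum => A; rewrite lee_fin.
move=> h; exists (fine (\esum_(i in [set: I]) (rnorm (u i) ^+ 2)%:E)) => A.
rewrite -lee_fin fineK ?psum_le_esum// ge0_fin_numE//.
by apply: esum_ge0 => i _; rewrite lee_fin.
Qed.

Lemma square_summable_submod : submod_closed square_summable.
Proof.
split=> [|a u v /square_summableP[M uM] /square_summableP[N vN]].
  apply/square_summableP; exists 0 => A; rewrite partial_sumE big1// => i _.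
  by rewrite rnorm0 expr0n.
apply/square_summableP; exists (2 * rnorm a ^+ 2 * M + 2 * N) => A.
have := uM A; have := vN A; rewrite !partial_sumE => vA uA.
apply: le_trans (_ : 2 * rnorm a ^+ 2 * (\sum_(i <- A) rnorm (u i) ^+ 2) +
   2 * \sum_(i <- A) rnorm (v i) ^+ 2 <= _); last first.
  by rewrite lerD// ler_wpM2l// mulr_ge0 ?sqr_ge0.
rewrite !mulr_sumr -big_split/=; apply: ler_sum => i _.
have h : rnorm ((a *: u + v) i) <= rnorm a * rnorm (u i) + rnorm (v i).
  by rewrite -rnormM rnormD.
have : rnorm ((a *: u + v) i) ^+ 2 <= (rnorm a * rnorm (u i) + rnorm (v i)) ^+ 2.
  by rewrite ler_sqr// nnegrE ?addr_ge0 ?mulr_ge0 ?rnorm_ge0.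
move=> /le_trans; apply.
have := sqr_ge0 (rnorm a * rnorm (u i) - rnorm (v i)).
by rewrite sqrrB sqrrD !exprMn; lra.
Qed.

HB.instance Definition _ :=
  GRing.isSubmodClosed.Build C (I -> C) square_summable square_summable_submod.

Record ell2 := Ell2 {
  ell2_fun :> I -> C ;
  ell2_fun_in : ell2_fun \in square_summable }.

HB.instance Definition _ := [isSub for ell2_fun].
HB.instance Definition _ := [Choice of ell2 by <:].
HB.instance Definition _ := [SubChoice_isSubLmodule of ell2 by <:].

Implicit Types u v w : ell2.

(* sum is the unordered sum: the limit along the net of finite subsets of I. *)
Definition inner u v : C := sum (fun i => u i * (v i)^*%C : C^o).

Lemma ell2E u v : (forall i, u i = v i) -> u = v.
Proof. by move=> h; apply/val_inj/funext. Qed.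

Lemma ell2D u v i : (u + v) i = u i + v i.
Proof. by []. Qed.

Lemma ell2Z a u i : (a *: u) i = a * u i.
Proof. by []. Qed.

Lemma cvg_inner u v :
  partial_sum (fun i => u i * (v i)^*%C : C^o) @ totally --> (inner u v : C^o).
Proof.
have /square_summableP[M uM] := ell2_fun_in u.
have /square_summableP[N vN] := ell2_fun_in v.
apply: (@cvg_psum_C _ _ (fun i => rnorm (u i) ^+ 2 + rnorm (v i) ^+ 2) _ (M + N)).
  move=> i; rewrite rnormE lecR rnormM rnorm_conj.
  have := sqr_ge0 (rnorm (u i) - rnorm (v i)).
  have := mulr_ge0 (rnorm_ge0 (u i)) (rnorm_ge0 (v i)).
  by rewrite sqrrB; lra.
move=> A; have := uM A; have := vN A; rewrite !partial_sumE big_split/=.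
by move=> h1 h2; exact: lerD.
Qed.

Lemma innerP u v (l : C) :
  partial_sum (fun i => u i * (v i)^*%C : C^o) @ totally --> (l : C^o) ->
  inner u v = l.
Proof. by move=> h; apply: norm_cvg_lim h. Qed.

Lemma innerDl u v w : inner (u + v) w = inner u w + inner v w.
Proof.
refine (innerP _); refine (eq_cvg_to _ (cvgD (cvg_inner (u := u) (v := w)) (cvg_inner (u := v) (v := w)))) => A.
by rewrite /= fctE !partial_sumE -big_split/=; apply: eq_bigr => i _; rewrite mulrDl. Qed.

Lemma innerZl a u v : inner (a *: u) v = a * inner u v.
Proof.
refine (innerP _); refine (eq_cvg_to _ (cvgZr (k := a) (cvg_inner (u := u) (v := v)))) => A.
by rewrite /= fctE !partial_sumE scaler_sumr; apply: eq_bigr => i _; rewrite -mulrA. Qed.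

Lemma cvg_conj (T : Type) (F : set_system T) (FF : Filter F) (f : T -> C^o) (l : C^o) :
  f @ F --> l -> (fun x => (f x)^*%C : C^o) @ F --> (l^*%C : C^o).
Proof.
move=> fl; apply/cvgrPdist_lt => e e0; move/cvgrPdist_lt : fl => /(_ _ e0).
by apply: filterS => x; rewrite -rmorphB/= normcJ.
Qed.

Lemma innerC u v : inner u v = (inner v u)^*%C.
Proof.
refine (innerP _); refine (eq_cvg_to _ (cvg_conj _ (cvg_inner (u := v) (v := u)))) => A.
rewrite /= !partial_sumE rmorph_sum; apply: eq_bigr => i _.
by rewrite rmorphM/= conjcK mulrC. Qed.

Lemma innerDr u v w : inner w (u + v) = inner w u + inner w v.
Proof. by rewrite innerC innerDl rmorphD/= -!innerC. Qed.

Lemma innerZr a u v : inner u (a *: v) = a^*%C * inner u v.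
Proof. by rewrite innerC innerZl rmorphM/= -innerC. Qed.

Lemma inner0l u : inner 0 u = 0.
Proof. by rewrite -[0](scale0r (0 : ell2)) innerZl mul0r. Qed.

Lemma inner0r u : inner u 0 = 0.
Proof. by rewrite innerC inner0l conjc0. Qed.

Lemma innerNl u v : inner (- u) v = - inner u v.
Proof. by rewrite -scaleN1r innerZl mulN1r. Qed.

Lemma innerNr u v : inner u (- v) = - inner u v.
Proof. by rewrite innerC innerNl rmorphN/= -innerC. Qed.

Definition hnorm2 u : R := sup (range (partial_sum (fun i => rnorm (u i) ^+ 2))).

Lemma innerE u : inner u u = (hnorm2 u)%:C.
Proof.
refine (innerP _).
have /square_summableP[M uM] := ell2_fun_in u.
have u0 i : 0 <= rnorm (u i) ^+ 2 by exact: sqr_ge0.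
refine (eq_cvg_to _ (cvgC _ (cvg_psum_ge0 u0 uM))) => A.
rewrite /= !partial_sumE rmorph_sum; apply: eq_bigr => i _ /=.
by rewrite -sqr_normc rnormE rmorphXn. Qed.

Lemma psum_le_hnorm2 u A : partial_sum (fun i => rnorm (u i) ^+ 2) A <= hnorm2 u.
Proof.
have /square_summableP[M uM] := ell2_fun_in u.
by apply: ub_le_sup; [exists M => _ [B _ <-]|exists A].
Qed.

Lemma hnorm2_le u M : (forall A, partial_sum (fun i => rnorm (u i) ^+ 2) A <= M) ->
  hnorm2 u <= M.
Proof.
move=> h; apply: ge_sup => [|_ [B _ <-]//].
by exists (partial_sum (fun i => rnorm (u i) ^+ 2) fset0), fset0.
Qed.

Lemma hnorm2_ge0 u : 0 <= hnorm2 u.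
Proof. by apply: le_trans (psum_le_hnorm2 u fset0); rewrite partial_sumE big_seq_fset0. Qed.

Lemma coord_le_hnorm2 u i : rnorm (u i) ^+ 2 <= hnorm2 u.
Proof. by have := psum_le_hnorm2 u [fset i]%fset; rewrite partial_sumE big_seq_fset1. Qed.

Definition hnorm u : R := Num.sqrt (complex.Re (inner u u)).

Lemma sqr_hnorm u : hnorm u ^+ 2 = hnorm2 u.
Proof. by rewrite /hnorm innerE/= sqr_sqrtr ?hnorm2_ge0. Qed.

Lemma hnorm_ge0 u : 0 <= hnorm u.
Proof. exact: sqrtr_ge0. Qed.

Lemma inner_hnorm u : inner u u = ((hnorm u) ^+ 2)%:C.
Proof. by rewrite innerE sqr_hnorm. Qed.

Lemma hnorm_eq0 u : hnorm u = 0 -> u = 0.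
Proof.
move=> h; apply: ell2E => i; apply: rnorm_eq0; apply/eqP.
have := coord_le_hnorm2 u i; rewrite -sqr_hnorm h expr0n/=.
by rewrite exprn_even_le0//=.
Qed.

Lemma hnormZ a u : hnorm (a *: u) = rnorm a * hnorm u.
Proof.
apply/eqP; rewrite -(eqrXn2 (n := 2))// ?mulr_ge0 ?rnorm_ge0 ?hnorm_ge0//; apply/eqP.
apply: complexI; rewrite -inner_hnorm innerZl innerZr mulrA -sqr_normc inner_hnorm.
by rewrite exprMn rnormE !expr2 !rmorphM/= ?mulrA.
Qed.

Lemma cauchy_schwarz u v : rnorm (inner u v) <= hnorm u * hnorm v.
Proof.
have [v0|v0] := eqVneq (hnorm v) 0.
  by rewrite (hnorm_eq0 v0) inner0r rnorm0 mulr_ge0// hnorm_ge0.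
have vp : 0 < hnorm v by rewrite lt_def v0 hnorm_ge0.
set b := (hnorm v ^+ 2)%:C; set a := inner u v.
have : 0 <= inner (b *: u - a *: v) (b *: u - a *: v).
  by rewrite inner_hnorm ler0c sqr_ge0.
rewrite !(innerDl, innerDr, innerNl, innerNr, innerZl, innerZr).
rewrite -/a (innerC v u) -/a !inner_hnorm -/b.
have -> : b^*%C = b by rewrite conjc_real.
rewrite [X in 0 <= X](_ : _ = b * (b * ((hnorm u) ^+ 2)%:C - a * a^*%C)); last by ring.
rewrite -sqr_normc rnormE -rmorphXn -/b -!rmorphM -rmorphB -rmorphM/= ler0c.
rewrite pmulr_rge0 ?exprn_gt0// subr_ge0 => h.
rewrite -ler_sqr ?nnegrE ?rnorm_ge0 ?mulr_ge0 ?hnorm_ge0//.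
by rewrite exprMn mulrC.
Qed.

Lemma Re_le_rnorm (z : C) : complex.Re z <= rnorm z.
Proof.
by apply: le_trans (ler_norm _) _; rewrite -lecR -rnormE normc_ge_Re.
Qed.

Lemma hnormD u v : hnorm (u + v) <= hnorm u + hnorm v.
Proof.
rewrite -ler_sqr ?nnegrE ?addr_ge0 ?hnorm_ge0//.
have -> : hnorm (u + v) ^+ 2 = complex.Re (inner (u + v) (u + v)).
  by rewrite inner_hnorm.
rewrite innerDl !innerDr !inner_hnorm (innerC v u) sqrrD.
have := cauchy_schwarz u v; have := Re_le_rnorm (inner u v).
by case: (inner u v) => x y /=; lra.
Qed.

Lemma ell2_normD u v : (hnorm (u + v))%:C <= (hnorm u)%:C + (hnorm v)%:C :> C.
Proof. by rewrite -rmorphD lecR hnormD. Qed.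

Lemma ell2_normZ (a : C) u : (hnorm (a *: u))%:C = `|a| * (hnorm u)%:C.
Proof. by rewrite hnormZ rmorphM/= rnormE. Qed.

Lemma ell2_norm_eq0 u : (hnorm u)%:C = 0 :> C -> u = 0.
Proof. by move=> /complexI /hnorm_eq0. Qed.

HB.instance Definition _ := Lmodule_isNormed.Build C ell2
  ell2_normD ell2_normZ ell2_norm_eq0.

Lemma rnorm_ell2 u : rnorm u = hnorm u.
Proof. by []. Qed.

End Ell2.

Section Basis.
Variables (R : realType) (I : choiceType).
Local Notation C := R[i].
Local Notation H := (ell2 R I).
Implicit Types (u v w : H) (A : {fset I}).

Lemma psum_supp (V : zmodType) (x : I -> V) (i : I) A :
  (forall j, j != i -> x j = 0) ->
  partial_sum x A = if i \in A then x i else 0.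
Proof.
move=> x0; rewrite partial_sumE; case: ifPn => iA.
  by rewrite (big_fsetD1 i)//= big_seq_cond big1 ?addr0// => j;
     rewrite !inE andbT => /andP[/x0].
by rewrite big_seq_cond big1// => j; rewrite andbT => jA; apply: x0;
   apply: contraNneq iA => <-.
Qed.

Definition basis_fun (i : I) : I -> C := fun j => (j == i)%:R.

Lemma basis_subproof i : basis_fun i \in @square_summable R I.
Proof.
apply/square_summableP; exists 1 => A; rewrite (@psum_supp _ _ i).
  by rewrite /basis_fun eqxx (rnormC 1) normr1 expr1n; case: ifP.
by move=> j ji; rewrite /basis_fun (negbTE ji) rnorm0 expr0n.
Qed.

Definition basis (i : I) : H := Ell2 (basis_subproof i).

Lemma cvg_psum_supp (x : I -> C^o) (i : I) :
  (forall j, j != i -> x j = 0) -> partial_sum x @ totally --> x i.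
Proof.
move=> x0; apply/cvgrPdist_lt => e e0; exists [fset i]%fset => //= A iA.
by rewrite (psum_supp A x0) (fsubsetP iA) ?inE// subrr normr0.
Qed.

Lemma inner_basisr u i : inner u (basis i) = u i.
Proof.
refine (innerP _).
have := @cvg_psum_supp (fun j => u j * (basis i j)^*%C) i.
rewrite /= /basis_fun eqxx conjc1 mulr1; apply => j ji.
by rewrite (negbTE ji) conjc0 mulr0.
Qed.

Lemma inner_basisl u i : inner (basis i) u = (u i)^*%C.
Proof. by rewrite innerC inner_basisr. Qed.

Definition trunc u A : H := \sum_(i <- A) u i *: basis i.

Lemma inner_suml (J : Type) (s : seq J) (f : J -> H) v :
  inner (\sum_(j <- s) f j) v = \sum_(j <- s) inner (f j) v.
Proof. by elim/big_ind2 : _ => [|x y z t <- <-|//]; rewrite ?inner0l ?innerDl. Qed.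

Lemma inner_sumr (J : Type) (s : seq J) (f : J -> H) v :
  inner v (\sum_(j <- s) f j) = \sum_(j <- s) inner v (f j).
Proof. by elim/big_ind2 : _ => [|x y z t <- <-|//]; rewrite ?inner0r ?innerDr. Qed.

Lemma inner_truncr u v A : inner v (trunc u A) = \sum_(i <- A) v i * (u i)^*%C.
Proof.
rewrite inner_sumr; apply: eq_bigr => i _.
by rewrite innerZr inner_basisr mulrC.
Qed.

Lemma inner_trunc u v A : inner (trunc u A) v = \sum_(i <- A) u i * (v i)^*%C.
Proof. by rewrite inner_suml; apply: eq_bigr => i _; rewrite innerZl inner_basisl. Qed.

Lemma truncE u A i : trunc u A i = if i \in A then u i else 0.
Proof.
rewrite -inner_basisr inner_trunc -(partial_sumE (fun j => u j * (basis i j)^*%C)).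
rewrite (@psum_supp _ _ i) /= /basis_fun ?eqxx ?conjc1 ?mulr1// => j ji.
by rewrite (negbTE ji) conjc0 mulr0.
Qed.

Lemma sum_sqr u A :
  \sum_(i <- A) u i * (u i)^*%C = (partial_sum (fun i => rnorm (u i) ^+ 2) A)%:C.
Proof.
rewrite partial_sumE rmorph_sum; apply: eq_bigr => i _ /=.
by rewrite -sqr_normc rnormE rmorphXn.
Qed.

Lemma sqr_hnorm_trunc u A :
  hnorm (trunc u A) ^+ 2 = partial_sum (fun i => rnorm (u i) ^+ 2) A.
Proof.
apply: complexI; rewrite -inner_hnorm inner_trunc -sum_sqr big_seq [RHS]big_seq.
by apply: eq_bigr => i iA; rewrite truncE iA.
Qed.

Lemma sqr_hnorm_truncB u A :
  hnorm (u - trunc u A) ^+ 2 =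
  hnorm2 u - partial_sum (fun i => rnorm (u i) ^+ 2) A.
Proof.
apply: complexI; rewrite -inner_hnorm innerDl !innerDr innerNl !innerNr innerNl.
rewrite [inner (trunc u A) (trunc u A)]inner_hnorm sqr_hnorm_trunc.
rewrite inner_truncr inner_trunc sum_sqr innerE rmorphB/=; ring.
Qed.

Lemma cvg_trunc u : trunc u @ totally --> u.
Proof.
have /square_summableP[M uM] := ell2_fun_in u.
have u0 i : 0 <= rnorm (u i) ^+ 2 by exact: sqr_ge0.
apply/cvgrPdist_lt => -[e e'].
rewrite ltcE /= => /andP[/eqP -> e0].
have /cvgrPdist_lt /(_ _ (exprn_gt0 2 e0)) := cvg_psum_ge0 u0 uM.
apply: filterS => A h; rewrite rnormE ltcR rnorm_ell2.
rewrite -ltr_sqr ?nnegrE ?hnorm_ge0 ?(ltW e0)// sqr_hnorm_truncB.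
by apply: le_lt_trans h; exact: ler_norm.
Qed.

End Basis.

Section BoundedOperators.
Variables (R : realType) (I : choiceType).
Local Notation C := R[i].
Local Notation H := (ell2 R I).
Implicit Types (u v w : H) (A : {fset I}).

Definition bounded_op : {pred H -> H} := fun T =>
  `[< linear T /\ exists M : R, forall u, rnorm (T u) <= M * rnorm u >].

Lemma bounded_opP (T : H -> H) : reflect
  (linear T /\ exists M : R, forall u, rnorm (T u) <= M * rnorm u)
  (T \in bounded_op).
Proof. by apply: (iffP idP) => [|h]; [move=> /asboolP|apply/asboolP]. Qed.

Lemma bounded_op_submod : submod_closed bounded_op.
Proof.
split=> [|a S T /bounded_opP[Sl [M SM]] /bounded_opP[Tl [N TN]]].
  apply/bounded_opP; split => [b u v|]; first by rewrite /= scaler0 addr0.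
  by exists 0 => u; rewrite rnorm0 mul0r.
apply/bounded_opP; split => [b u v|].
  rewrite !fctE Sl Tl !scalerDr !scalerA mulrC -!addrA; congr (_ + _).
  by rewrite addrCA.
exists (rnorm a * M + N) => u; rewrite mulrDl (le_trans (rnormD _ _))// lerD//.
by rewrite rnorm_ell2 fctE hnormZ -mulrA ler_wpM2l ?rnorm_ge0//; exact: SM.
Qed.

HB.instance Definition _ :=
  GRing.isSubmodClosed.Build C (H -> H) bounded_op bounded_op_submod.

Record bop := Bop {
  bop_fun :> H -> H ;
  bop_in : bop_fun \in bounded_op }.

HB.instance Definition _ := [isSub for bop_fun].
HB.instance Definition _ := [Choice of bop by <:].
HB.instance Definition _ := [SubChoice_isSubLmodule of bop by <:].

Implicit Types S T : bop.

Lemma bop_linear T : linear T.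
Proof. by case/bounded_opP : (bop_in T). Qed.

HB.instance Definition _ T := GRing.isLinear.Build C H H *:%R T (bop_linear T).

Lemma bopE S T : (forall u, S u = T u) -> S = T.
Proof. by move=> h; apply/val_inj/funext. Qed.

(* bop R I is B(l^2(I)): all bounded linear operators, with the operator norm. *)
Definition opnorm T : R :=
  sup [set rnorm (T u) | u in [set u | rnorm u <= 1]].

Lemma has_sup_opnorm T : has_sup [set rnorm (T u) | u in [set u | rnorm u <= 1]].
Proof.
have /bounded_opP[_ [M TM]] := bop_in T.
split; first by exists (rnorm (T 0)), 0 => //=; rewrite rnorm0.
exists `|M| => _ [u /= u1 <-]; apply: le_trans (TM u) _.
apply: le_trans (ler_wpM2r (rnorm_ge0 _) (ler_norm M)) _.
by rewrite ler_piMr.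
Qed.

Lemma opnorm_ge0 T : 0 <= opnorm T.
Proof.
apply: le_trans (rnorm_ge0 (T 0)) _.
by apply: ub_le_sup; [case: (has_sup_opnorm T)|exists 0 => //=; rewrite rnorm0].
Qed.

Lemma opnormP T u : rnorm (T u) <= opnorm T * rnorm u.
Proof.
have [u0|u0] := eqVneq (rnorm u) 0.
  by rewrite (rnorm_eq0 u0) linear0 rnorm0 mulr0.
have up : 0 < rnorm u by rewrite lt_def u0 rnorm_ge0.
have h : rnorm (T (((rnorm u)^-1)%:C *: u)) <= opnorm T.
  apply: ub_le_sup; first by case: (has_sup_opnorm T).
  exists (((rnorm u)^-1)%:C *: u) => //=.
  by rewrite rnorm_ell2 hnormZ rnormC gtr0_norm ?invr_gt0// -rnorm_ell2 mulVf.
move: h; rewrite linearZ/= rnorm_ell2 hnormZ rnormC gtr0_norm ?invr_gt0//.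
by rewrite ler_pdivrMl// mulrC.
Qed.

Lemma opnorm_le T M : 0 <= M -> (forall u, rnorm (T u) <= M * rnorm u) ->
  opnorm T <= M.
Proof.
move=> M0 TM; apply: ge_sup; first by case: (has_sup_opnorm T).
by move=> _ [u /= u1 <-]; rewrite (le_trans (TM u))// ler_piMr.
Qed.

Lemma bop_normD S T : (opnorm (S + T))%:C <= (opnorm S)%:C + (opnorm T)%:C :> C.
Proof.
rewrite -rmorphD lecR; apply: opnorm_le => [|u]; first by rewrite addr_ge0 ?opnorm_ge0.
by rewrite mulrDl (le_trans (rnormD _ _))// lerD ?opnormP.
Qed.

Lemma bop_norm_eq0 T : (opnorm T)%:C = 0 :> C -> T = 0.
Proof.
move=> /complexI T0; apply: bopE => u; apply/rnorm_eq0/eqP.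
by rewrite eq_le rnorm_ge0 andbT; have := opnormP T u; rewrite T0 mul0r.
Qed.

Lemma bop_normZ (a : C) T : (opnorm (a *: T))%:C = `|a| * (opnorm T)%:C.
Proof.
have le b S : opnorm (b *: S) <= rnorm b * opnorm S.
  apply: opnorm_le => [|u]; first by rewrite mulr_ge0 ?rnorm_ge0 ?opnorm_ge0.
  by rewrite [_ u]/(b *: S u) rnorm_ell2 hnormZ -mulrA ler_wpM2l ?rnorm_ge0 ?opnormP.
rewrite rnormE -rmorphM/=; congr (_ %:C); apply/eqP; rewrite eq_le le/=.
have [->|a0] := eqVneq a 0; first by rewrite rnorm0 mul0r opnorm_ge0.
have ap : 0 < rnorm a.
  by rewrite lt_def rnorm_ge0 andbT; apply: contra_neq a0 => /rnorm_eq0.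
have := le (a^-1) (a *: T); rewrite scalerA (mulVf a0) scale1r.
have -> : rnorm (a^-1) = (rnorm a)^-1.
  apply: (mulfI (lt0r_neq0 ap)); rewrite -rnormM (mulfV a0) mulfV ?lt0r_neq0//.
  by rewrite (rnormC 1) normr1.
by rewrite ler_pdivlMl.
Qed.

HB.instance Definition _ := Lmodule_isNormed.Build C bop
  bop_normD bop_normZ bop_norm_eq0.

Lemma rnorm_bop T : rnorm T = opnorm T.
Proof. by []. Qed.

Lemma bop1_in : @idfun H \in bounded_op.
Proof. by apply/bounded_opP; split => //; exists 1 => u; rewrite mul1r. Qed.

Definition bop1 := Bop bop1_in.

Lemma bop_comp_in S T : S \o T \in bounded_op.
Proof.
apply/bounded_opP; split => [a u v|]; first by rewrite /= !linearP.
exists (opnorm S * opnorm T) => u; rewrite (le_trans (opnormP _ _))// -mulrA.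
by rewrite ler_wpM2l ?opnorm_ge0 ?opnormP.
Qed.

Definition bop_comp S T := Bop (bop_comp_in S T).

Lemma bop_compA : associative bop_comp. Proof. by move=> *; exact: bopE. Qed.
Lemma bop_comp1l : left_id bop1 bop_comp. Proof. by move=> *; exact: bopE. Qed.
Lemma bop_comp1r : right_id bop1 bop_comp. Proof. by move=> *; exact: bopE. Qed.
Lemma bop_compDl : left_distributive bop_comp +%R.
Proof. by move=> *; exact: bopE. Qed.
Lemma bop_compDr : right_distributive bop_comp +%R.
Proof. by move=> S T U; apply: bopE => u; exact: linearD. Qed.

Lemma cvg_inner_fst (u v : H) (F : set_system {fset I}) (FF : ProperFilter F)
  (f : {fset I} -> H) :
  f @ F --> u -> (fun A => inner (f A) v : C^o) @ F --> (inner u v : C^o).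
Proof.
move=> fu; apply/cvgrPdist_lt => -[e e'].
rewrite ltcE /= => /andP[/eqP -> e0].
have M0 : 0 < hnorm v + 1 by rewrite ltr_wpDl ?hnorm_ge0.
have h0 : (0 : C) < (e / (hnorm v + 1))%:C by rewrite ltcR divr_gt0.
move/cvgrPdist_lt : fu => /(_ _ h0); apply: filterS => A.
rewrite rnormE ltcR ltr_pdivlMr// => hA.
rewrite -innerNl -innerDl rnormE ltcR.
apply: le_lt_trans (cauchy_schwarz _ _) _; apply: le_lt_trans hA.
by rewrite rnorm_ell2 ler_wpM2l ?hnorm_ge0// lerDl.
Qed.

(* Existence of adjoints: T* v has coordinates <v, T e_i>. *)
Definition adj_fun T v : I -> C := fun i => inner v (T (basis R i)).

Lemma adj_subproof T v : adj_fun T v \in @square_summable R I.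
Proof.
apply/square_summableP; exists ((opnorm T * hnorm v) ^+ 2) => A.
set s := partial_sum _ _.
have s0 : 0 <= s by rewrite /s partial_sumE sumr_ge0// => i _; exact: sqr_ge0.
pose x : H := \sum_(i <- A) adj_fun T v i *: basis R i.
have xE i : x i = if i \in A then adj_fun T v i else 0.
  rewrite -inner_basisr inner_suml.
  under eq_bigr do rewrite innerZl inner_basisl.
  rewrite -(partial_sumE (fun j => adj_fun T v j * (basis R i j)^*%C)).
  rewrite (@psum_supp _ _ _ i) /= /basis_fun ?eqxx ?conjc1 ?mulr1// => j ji.
  by rewrite (negbTE ji) conjc0 mulr0.
have xs : inner x x = s%:C.
  rewrite {1}/x inner_suml /s partial_sumE rmorph_sum /= big_seq [RHS]big_seq.
  apply: eq_bigr => i iA; rewrite innerZl inner_basisl xE iA.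
  by rewrite -sqr_normc rnormE rmorphXn.
have xn : hnorm x ^+ 2 = s by apply: complexI; rewrite -inner_hnorm.
have Tx : inner v (T x) = s%:C.
  rewrite /x linear_sum inner_sumr /s partial_sumE rmorph_sum /=.
  apply: eq_bigr => i _; rewrite linearZ innerZr -/(adj_fun T v i) mulrC.
  by rewrite -sqr_normc rnormE rmorphXn.
have : s <= hnorm v * (opnorm T * hnorm x).
  have -> : s = rnorm (inner v (T x)) by rewrite Tx rnormC ger0_norm.
  apply: le_trans (cauchy_schwarz _ _) _.
  by rewrite ler_wpM2l ?hnorm_ge0//; have := opnormP T x; rewrite !rnorm_ell2.
rewrite -xn; have [->|x0] := eqVneq (hnorm x) 0 => h.
  by rewrite expr0n/= sqr_ge0.
have xp : 0 < hnorm x by rewrite lt_def x0 hnorm_ge0.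
move: h; rewrite mulrA expr2 ler_pM2r// => h.
by rewrite ler_sqr ?nnegrE ?hnorm_ge0 ?mulr_ge0 ?opnorm_ge0 ?hnorm_ge0// mulrC.
Qed.

Lemma adj_fun_spec T u v : inner (T u) v = inner u (Ell2 (adj_subproof T v)).
Proof.
apply/esym; refine (innerP _).
have h : (fun A => inner (T (trunc u A)) v : C^o) @ totally --> (inner (T u) v : C^o).
  apply: cvg_inner_fst; apply/cvgrPdist_lt => -[e e'].
  rewrite ltcE /= => /andP[/eqP -> e0].
  have M0 : 0 < opnorm T + 1 by rewrite ltr_wpDl ?opnorm_ge0.
  have h0 : (0 : C) < (e / (opnorm T + 1))%:C by rewrite ltcR divr_gt0.
  have /cvgrPdist_lt /(_ _ h0) := cvg_trunc (u := u); apply: filterS => A.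
  rewrite rnormE ltcR ltr_pdivlMr// => hA.
  rewrite -linearB rnormE ltcR; apply: le_lt_trans (opnormP _ _) _.
  by apply: le_lt_trans hA; rewrite mulrC ler_wpM2l ?rnorm_ge0// lerDl.
refine (eq_cvg_to _ h) => A.
rewrite linear_sum inner_suml partial_sumE; apply: eq_bigr => i _.
by rewrite linearZ innerZl /= /adj_fun -innerC.
Qed.

Lemma inner_inj v w : (forall u, inner u v = inner u w) -> v = w.
Proof.
move=> h; apply: ell2E => i; have := h (basis R i).
by rewrite !inner_basisl => /(congr1 conjc); rewrite !conjcK.
Qed.

Lemma adjoint_exists T :
  exists T' : bop, forall u v, inner (T u) v = inner u (T' v).
Proof.
have h : (fun v => Ell2 (adj_subproof T v)) \in bounded_op.
  apply/bounded_opP; split => [a v w|].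
    by apply: inner_inj => u; rewrite innerDr innerZr -!adj_fun_spec innerDr innerZr.
  exists (opnorm T) => v; set w := Ell2 _.
  have : hnorm w ^+ 2 <= opnorm T * hnorm w * hnorm v.
    have -> : hnorm w ^+ 2 = rnorm (inner (T w) v).
      by rewrite adj_fun_spec -/w inner_hnorm rnormC ger0_norm ?sqr_ge0.
    apply: le_trans (cauchy_schwarz _ _) _.
    by rewrite ler_wpM2r ?hnorm_ge0//; have := opnormP T w; rewrite !rnorm_ell2.
  rewrite !rnorm_ell2 => hw; have [->|w0] := eqVneq (hnorm w) 0.
    by rewrite mulr_ge0 ?opnorm_ge0 ?hnorm_ge0.
  have wp : 0 < hnorm w by rewrite lt_def w0 hnorm_ge0.
  by move: hw; rewrite expr2 mulrAC ler_pM2r.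
by exists (Bop h) => u v; exact: adj_fun_spec.
Qed.

Definition adjoint T : bop := sval (cid (adjoint_exists T)).

Lemma adjointP T u v : inner (T u) v = inner u (adjoint T v).
Proof. exact: (svalP (cid (adjoint_exists T)) u v). Qed.

Lemma adjoint_uniq T T' : (forall u v, inner (T u) v = inner u (T' v)) ->
  adjoint T = T'.
Proof. by move=> h; apply: bopE => v; apply: inner_inj => u; rewrite -h adjointP. Qed.

Lemma adjointK : involutive adjoint.
Proof.
by move=> T; apply: adjoint_uniq => u v; rewrite innerC -adjointP -innerC.
Qed.

Lemma adjointD : {morph adjoint : S T / S + T}.
Proof.
by move=> S T; apply: adjoint_uniq => u v; rewrite innerDl !adjointP -innerDr.
Qed.

Lemma adjointZ a T : adjoint (a *: T) = a^*%C *: adjoint T.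
Proof.
by apply: adjoint_uniq => u v; rewrite innerZl innerZr conjcK adjointP.
Qed.

Lemma adjointM S T : adjoint (bop_comp S T) = bop_comp (adjoint T) (adjoint S).
Proof. by apply: adjoint_uniq => u v; rewrite /= !adjointP. Qed.

Lemma bop_normM S T : `|bop_comp S T| <= `|S| * `|T|.
Proof.
rewrite !rnormE -rmorphM lecR !rnorm_bop; apply: opnorm_le.
  by rewrite mulr_ge0 ?opnorm_ge0.
move=> u; rewrite /= (le_trans (opnormP _ _))// -mulrA.
by rewrite ler_wpM2l ?opnorm_ge0 ?opnormP.
Qed.

Lemma opnorm_adjoint_le T : opnorm (adjoint T) <= opnorm T.
Proof.
apply: opnorm_le => [|v]; first exact: opnorm_ge0.
set w := adjoint T v; rewrite !rnorm_ell2.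
have : hnorm w ^+ 2 <= opnorm T * hnorm w * hnorm v.
  have -> : hnorm w ^+ 2 = rnorm (inner (T w) v).
    by rewrite adjointP -/w inner_hnorm rnormC ger0_norm ?sqr_ge0.
  apply: le_trans (cauchy_schwarz _ _) _.
  by rewrite ler_wpM2r ?hnorm_ge0//; have := opnormP T w; rewrite !rnorm_ell2.
move=> hw; have [->|w0] := eqVneq (hnorm w) 0.
  by rewrite mulr_ge0 ?opnorm_ge0 ?hnorm_ge0.
have wp : 0 < hnorm w by rewrite lt_def w0 hnorm_ge0.
by move: hw; rewrite expr2 mulrAC ler_pM2r.
Qed.

Lemma bop_norm_adjoint T : `|adjoint T| = `|T|.
Proof.
rewrite !rnormE !rnorm_bop; congr (_ %:C); apply/eqP.
by rewrite eq_le opnorm_adjoint_le/= -{1}[T]adjointK opnorm_adjoint_le.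
Qed.

Lemma bop_scalerAl (a : C) S T : a *: bop_comp S T = bop_comp (a *: S) T.
Proof. exact: bopE. Qed.

Lemma bop_scalerAr (a : C) S T : a *: bop_comp S T = bop_comp S (a *: T).
Proof. by apply: bopE => u; rewrite [RHS]linearZ. Qed.

End BoundedOperators.

(* Unital normed *-algebras; 0 = 1 is allowed, so that every quotient by a
   closed ideal is an instance.  This is the level of structure used by the
   notions below (closed ideals, states, dynamics, KMS condition); the
   C*-identity is not recorded.  The algebras of interest are closed
   *-subalgebras of B(l^2) and their quotients by closed *-ideals, with the
   operator norm and the quotient norm respectively.  The MathComp ring
   structures are not used because no structure of the hierarchy joins a ring
   with a norm valued in another type. *)
HB.mixin Record isNormedStarAlgebra (R : realType) A of NormedModule R[i] A := {
  aone : A ;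
  amul : A -> A -> A ;
  star : A -> A ;
  amulA : associative amul ;
  amul1l : left_id aone amul ;
  amul1r : right_id aone amul ;
  amulDl : left_distributive amul +%R ;
  amulDr : right_distributive amul +%R ;
  amulZl : forall (a : R[i]) (x y : A), a *: amul x y = amul (a *: x) y ;
  amulZr : forall (a : R[i]) (x y : A), a *: amul x y = amul x (a *: y) ;
  starK : involutive star ;
  starD : {morph star : x y / x + y} ;
  starZ : forall (a : R[i]) x, star (a *: x) = a^*%C *: star x ;
  starM : forall x y, star (amul x y) = amul (star y) (star x) ;
  norm_amul : forall x y : A, `|amul x y| <= `|x| * `|y| ;
  norm_star : forall x : A, `|star x| = `|x| }.

#[short(type="normedStarAlgType")]
HB.structure Definition NormedStarAlgebra (R : realType) :=
  { A of isNormedStarAlgebra R A & NormedModule R[i] A }.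

Notation "x ** y" := (amul x y) (at level 40, left associativity) : ring_scope.

HB.instance Definition _ (R : realType) (I : choiceType) :=
  isNormedStarAlgebra.Build R (bop R I)
    (@bop_compA R I) (@bop_comp1l R I) (@bop_comp1r R I)
    (@bop_compDl R I) (@bop_compDr R I)
    (@bop_scalerAl R I) (@bop_scalerAr R I)
    (@adjointK R I) (@adjointD R I) (@adjointZ R I) (@adjointM R I)
    (@bop_normM R I) (@bop_norm_adjoint R I).

Section Substructures.
Variables (R : realType) (A : normedStarAlgType R).

Lemma star0 : star (0 : A) = 0.
Proof. by rewrite -[0](scale0r (0 : A)) starZ conjc0 !scale0r. Qed.

Lemma starN : {morph @star R A : x / - x}.
Proof. move=> x; rewrite -scaleN1r starZ.
have -> : (-1)^*%C = -1 :> R[i] by apply/eqP; rewrite eq_complex /= !oppr0 !eqxx.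
by rewrite scaleN1r. Qed.

Lemma amulNl (x y : A) : (- x) ** y = - (x ** y).
Proof. by rewrite -[RHS]scaleN1r -[- x]scaleN1r amulZl. Qed.

Lemma amulNr (x y : A) : x ** (- y) = - (x ** y).
Proof. by rewrite -[RHS]scaleN1r -[- y]scaleN1r amulZr. Qed.

Definition star_subalgebra (B : set A) : Prop :=
  [/\ B 0, forall x y, B x -> B y -> B (x + y),
      forall (a : R[i]) x, B x -> B (a *: x),
      forall x y, B x -> B y -> B (x ** y) & forall x, B x -> B (star x)].

(* The smallest norm-closed *-subalgebra containing G (no unit is added). *)
Definition cstar_gen (G : set A) : set A :=
  smallest (fun B => star_subalgebra B /\ closed B) G.

Definition two_sided_ideal (J : set A) : Prop :=
  [/\ J 0, forall x y, J x -> J y -> J (x + y),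
      forall (a : R[i]) x, J x -> J (a *: x),
      forall x y, J y -> J (x ** y) & forall x y, J x -> J (x ** y)].

Definition closed_ideal_gen (G : set A) : set A :=
  smallest (fun J => two_sided_ideal J /\ closed J) G.

Lemma cstar_gen_subalgebra G : star_subalgebra (cstar_gen G).
Proof.
split=> [B [[[]]]//|x y Bx By B BG|a x Bx B BG|x y Bx By B BG|x Bx B BG];
  case: (BG) => -[[B0 BD BZ BM BS] _] _.
- by apply: BD; [exact: Bx|exact: By].
- by apply: BZ; exact: Bx.
- by apply: BM; [exact: Bx|exact: By].
- by apply: BS; exact: Bx.
Qed.

Lemma closed_ideal_gen_ideal G : two_sided_ideal (closed_ideal_gen G).
Proof.
split=> [B [[[]]]//|x y Bx By B BG|a x Bx B BG|x y By B BG|x y Bx B BG];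
  case: (BG) => -[[B0 BD BZ Bl Br] _] _.
- by apply: BD; [exact: Bx|exact: By].
- by apply: BZ; exact: Bx.
- by apply: Bl; exact: By.
- by apply: Br; exact: Bx.
Qed.

Lemma closed_ideal_gen_closed G : closed (closed_ideal_gen G).
Proof. by apply: closed_bigI => B [[_ ?] _]. Qed.

Lemma star_continuous : continuous (@star R A).
Proof.
move=> x; apply/cvgrPdist_lt => e e0.
have /cvgrPdist_lt /(_ _ e0) := @cvg_id _ (nbhs x).
by apply: filterS => y; rewrite -starN -starD norm_star.
Qed.

Lemma closed_ideal_gen_star G : (forall x, G x -> G (star x)) ->
  forall x, closed_ideal_gen G x -> closed_ideal_gen G (star x).
Proof.
move=> Gs; apply: smallest_sub; last first.
  by move=> x /Gs Gx B BG; case: (BG) => _; exact.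
have [J0 JD JZ Jl Jr] := closed_ideal_gen_ideal G.
split; last first.
  apply: (@preimage_closed _ _ (@star R A)) => [x _|]; last exact: closed_ideal_gen_closed.
  exact: star_continuous.
split=> [|x y Jx Jy|a x Jx|x y Jy|x y Jx] /=.
- by rewrite star0.
- by rewrite starD; exact: JD.
- by rewrite starZ; exact: JZ.
- by rewrite starM; exact: Jr.
- by rewrite starM; exact: Jl.
Qed.

End Substructures.

Section StarSubalgebra.
Variables (R : realType) (A : normedStarAlgType R).

Record unital_star_subalgebra := UnitalStarSubalgebra {
  uss_set :> set A ;
  uss_sub : star_subalgebra uss_set ;
  uss_one : uss_set aone }.

Variable B : unital_star_subalgebra.

Definition uss_pred : {pred A} := fun x => `[< uss_set B x >].

Lemma uss_predP x : reflect (uss_set B x) (x \in uss_pred).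
Proof. exact: asboolP. Qed.

Lemma uss_submod : submod_closed uss_pred.
Proof.
have [B0 BD BZ _ _] := uss_sub B.
split=> [|a x y /uss_predP Bx /uss_predP By]; apply/uss_predP => //.
by apply: BD => //; exact: BZ.
Qed.

HB.instance Definition _ := GRing.isSubmodClosed.Build R[i] A uss_pred uss_submod.

Record subalg := Subalg { subalg_val :> A ; subalg_in : subalg_val \in uss_pred }.

HB.instance Definition _ := [isSub for subalg_val].
HB.instance Definition _ := [Choice of subalg by <:].
HB.instance Definition _ := [SubChoice_isSubLmodule of subalg by <:].

Implicit Types x y : subalg.

Lemma subalgP x : uss_set B (subalg_val x).
Proof. exact/uss_predP/subalg_in. Qed.

Lemma subalg_inj x y : subalg_val x = subalg_val y -> x = y.
Proof. by move=> h; exact/val_inj. Qed.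

Lemma subalg_one_in : aone \in uss_pred.
Proof. exact/uss_predP/uss_one. Qed.

Lemma subalg_mul_in x y : subalg_val x ** subalg_val y \in uss_pred.
Proof. by apply/uss_predP; have [_ _ _ BM _] := uss_sub B; apply: BM; exact: subalgP. Qed.

Lemma subalg_star_in x : star (subalg_val x) \in uss_pred.
Proof. by apply/uss_predP; have [_ _ _ _ BS] := uss_sub B; apply: BS; exact: subalgP. Qed.

Definition subalg_one := Subalg subalg_one_in.
Definition subalg_mul x y := Subalg (subalg_mul_in x y).
Definition subalg_star x := Subalg (subalg_star_in x).

Lemma subalg_mulA : associative subalg_mul.
Proof. by move=> x y z; apply: subalg_inj; exact: amulA. Qed.
Lemma subalg_mul1 : left_id subalg_one subalg_mul.
Proof. by move=> x; apply: subalg_inj; exact: amul1l. Qed.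
Lemma subalg_mulr1 : right_id subalg_one subalg_mul.
Proof. by move=> x; apply: subalg_inj; exact: amul1r. Qed.
Lemma subalg_mulDl : left_distributive subalg_mul +%R.
Proof. by move=> x y z; apply: subalg_inj; exact: amulDl. Qed.
Lemma subalg_mulDr : right_distributive subalg_mul +%R.
Proof. by move=> x y z; apply: subalg_inj; exact: amulDr. Qed.

Lemma subalg_normD x y :
  `|subalg_val (x + y)| <= `|subalg_val x| + `|subalg_val y|.
Proof. exact: ler_normD. Qed.
Lemma subalg_normZ (a : R[i]) x :
  `|subalg_val (a *: x)| = `|a| * `|subalg_val x|.
Proof. exact: normrZ. Qed.
Lemma subalg_norm_eq0 x : `|subalg_val x| = 0 -> x = 0.
Proof. by move=> /normr0_eq0 h; exact: subalg_inj. Qed.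

HB.instance Definition _ := Lmodule_isNormed.Build R[i] subalg
  subalg_normD subalg_normZ subalg_norm_eq0.

Lemma subalg_starK : involutive subalg_star.
Proof. by move=> x; apply: subalg_inj; exact: starK. Qed.
Lemma subalg_starD : {morph subalg_star : x y / x + y}.
Proof. by move=> x y; apply: subalg_inj; exact: starD. Qed.
Lemma subalg_starZ (a : R[i]) x : subalg_star (a *: x) = a^*%C *: subalg_star x.
Proof. by apply: subalg_inj; exact: starZ. Qed.
Lemma subalg_starM x y : subalg_star (subalg_mul x y) = subalg_mul (subalg_star y) (subalg_star x).
Proof. by apply: subalg_inj; exact: starM. Qed.
Lemma subalg_scalerAl (a : R[i]) x y : a *: subalg_mul x y = subalg_mul (a *: x) y.
Proof. by apply: subalg_inj; exact: amulZl. Qed.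
Lemma subalg_scalerAr (a : R[i]) x y : a *: subalg_mul x y = subalg_mul x (a *: y).
Proof. by apply: subalg_inj; exact: amulZr. Qed.
Lemma subalg_normM x y : `|subalg_mul x y| <= `|x| * `|y|.
Proof. exact: norm_amul. Qed.
Lemma subalg_norm_star x : `|subalg_star x| = `|x|.
Proof. exact: norm_star. Qed.

HB.instance Definition _ := isNormedStarAlgebra.Build R subalg
  subalg_mulA subalg_mul1 subalg_mulr1 subalg_mulDl subalg_mulDr
  subalg_scalerAl subalg_scalerAr
  subalg_starK subalg_starD subalg_starZ subalg_starM
  subalg_normM subalg_norm_star.

End StarSubalgebra.

Section StarQuotient.
Variables (R : realType) (A : normedStarAlgType R).

(* Closed ideals of a C*-algebra are automatically stable under star; for ideals
   generated by a self-adjoint set this is closed_ideal_gen_star. *)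
Record closed_star_ideal := ClosedStarIdeal {
  csi_set :> set A ;
  csi_ideal : two_sided_ideal csi_set ;
  csi_closed : closed csi_set ;
  csi_star : forall x, csi_set x -> csi_set (star x) }.

Variable J : closed_star_ideal.

Definition csi_pred : {pred A} := fun x => `[< csi_set J x >].

Lemma csi_predP x : reflect (csi_set J x) (x \in csi_pred).
Proof. exact: asboolP. Qed.

Lemma csi_zmod : zmod_closed csi_pred.
Proof.
have [J0 JD JZ _ _] := csi_ideal J.
split=> [|x y /csi_predP Jx /csi_predP Jy]; apply/csi_predP => //.
by apply: JD => //; rewrite -scaleN1r; exact: JZ.
Qed.

HB.instance Definition _ := GRing.isZmodClosed.Build A csi_pred csi_zmod.

Definition quotalg : Type := Quotient.quot (csi_pred : zmodClosed A).

HB.instance Definition _ := GRing.Zmodule.on quotalg.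

Definition qpi (x : A) : quotalg :=
  (\pi_(Quotient.quot (csi_pred : zmodClosed A)) x)%qT.

Lemma qpi_eqP x y : qpi x = qpi y <-> csi_set J (x - y).
Proof.
split=> [/eqP|h]; first by rewrite /qpi -Quotient.idealrBE => /csi_predP.
by apply/eqP; rewrite /qpi -Quotient.idealrBE; exact/csi_predP.
Qed.

Lemma qpi_surj q : exists x, qpi x = q.
Proof. by exists (repr q); rewrite /qpi reprK. Qed.

Lemma qpiD : {morph qpi : x y / x + y}.
Proof. by move=> x y; exact: raddfD. Qed.

Lemma qpi0 : qpi 0 = 0.
Proof. exact: raddf0. Qed.

Lemma qpi_repr q : qpi (repr q) = q.
Proof. exact: reprK. Qed.

Definition qscale (a : R[i]) (q : quotalg) : quotalg := qpi (a *: repr q).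
Definition qmul (p q : quotalg) : quotalg := qpi (repr p ** repr q).
Definition qstar (q : quotalg) : quotalg := qpi (star (repr q)).

Lemma qpiZ_sub a x : qpi (a *: x) = qscale a (qpi x).
Proof.
apply/qpi_eqP; rewrite -scalerBr; have [_ _ JZ _ _] := csi_ideal J.
by apply/JZ/qpi_eqP; rewrite qpi_repr.
Qed.

Lemma qpiM_sub x y : qpi (x ** y) = qmul (qpi x) (qpi y).
Proof.
apply/qpi_eqP; have [_ JD _ Jl Jr] := csi_ideal J.
rewrite (_ : _ - _ = x ** (y - repr (qpi y)) + (x - repr (qpi x)) ** repr (qpi y)).
  by apply: JD; [apply: Jl|apply: Jr]; apply/qpi_eqP; rewrite qpi_repr.
by rewrite amulDr amulDl amulNr amulNl addrA addrNK.
Qed.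

Lemma qpi_star_sub x : qpi (star x) = qstar (qpi x).
Proof.
by apply/qpi_eqP; rewrite -starN -starD; apply/csi_star/qpi_eqP; rewrite qpi_repr.
Qed.

Lemma qscaleA a b q : qscale a (qscale b q) = qscale (a * b) q.
Proof. by have [x <-] := qpi_surj q; rewrite -!qpiZ_sub scalerA. Qed.
Lemma qscale1 : left_id 1 qscale.
Proof. by move=> q; have [x <-] := qpi_surj q; rewrite -qpiZ_sub scale1r. Qed.
Lemma qscaleDr : right_distributive qscale +%R.
Proof.
move=> a p q; have [x <-] := qpi_surj p; have [y <-] := qpi_surj q.
by rewrite -qpiD -!qpiZ_sub scalerDr qpiD.
Qed.
Lemma qscaleDl q : {morph qscale^~ q : a b / a + b}.
Proof.
by move=> a b; have [x <-] := qpi_surj q; rewrite -!qpiZ_sub scalerDl qpiD.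
Qed.

HB.instance Definition _ := GRing.Zmodule_isLmodule.Build R[i] quotalg
  qscaleA qscale1 qscaleDr qscaleDl.

Lemma qpiZ (a : R[i]) x : qpi (a *: x) = a *: qpi x.
Proof. exact: qpiZ_sub. Qed.

Lemma qmulA : associative qmul.
Proof.
move=> p q r; have [x <-] := qpi_surj p; have [y <-] := qpi_surj q.
by have [z <-] := qpi_surj r; rewrite -!qpiM_sub amulA.
Qed.
Lemma qmul1 : left_id (qpi aone) qmul.
Proof. by move=> q; have [x <-] := qpi_surj q; rewrite -qpiM_sub amul1l. Qed.
Lemma qmulr1 : right_id (qpi aone) qmul.
Proof. by move=> q; have [x <-] := qpi_surj q; rewrite -qpiM_sub amul1r. Qed.
Lemma qmulDl : left_distributive qmul +%R.
Proof.
move=> p q r; have [x <-] := qpi_surj p; have [y <-] := qpi_surj q.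
by have [z <-] := qpi_surj r; rewrite -qpiD -!qpiM_sub amulDl qpiD.
Qed.
Lemma qmulDr : right_distributive qmul +%R.
Proof.
move=> p q r; have [x <-] := qpi_surj p; have [y <-] := qpi_surj q.
by have [z <-] := qpi_surj r; rewrite -qpiD -!qpiM_sub amulDr qpiD.
Qed.

(* The quotient norm: qnorm (qpi x) is the distance from x to the ideal. *)
Definition qnorm (q : quotalg) : R := inf [set rnorm x | x in [set x | qpi x = q]].

Lemma qnorm_le x : qnorm (qpi x) <= rnorm x.
Proof.
by apply: ge_inf; [exists 0 => _ [y _ <-]; exact: rnorm_ge0|exists x].
Qed.

Lemma le_qnorm q (c M : R) : 0 <= c -> (forall x, qpi x = q -> M <= c * rnorm x) ->
  M <= c * qnorm q.
Proof.
rewrite le_eqVlt => /predU1P[<-|c0] h.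
  by have [x /h] := qpi_surj q; rewrite !mul0r.
rewrite -ler_pdivrMl//; apply: lb_le_inf.
  by have [x xq] := qpi_surj q; exists (rnorm x), x.
by move=> _ [x /= /h xq <-]; rewrite ler_pdivrMl.
Qed.

Lemma qnorm_ge0 q : 0 <= qnorm q.
Proof.
by have := @le_qnorm q 1 0 ler01; rewrite mul1r; apply => x _; rewrite mul1r rnorm_ge0.
Qed.

Lemma qnorm_near q (e : R) : 0 < e -> exists2 x, qpi x = q & rnorm x < qnorm q + e.
Proof.
move=> e0; apply: contrapT => h.
suff : qnorm q + e <= 1 * qnorm q by rewrite mul1r -[leRHS]addr0 lerD2l leNgt e0.
apply: le_qnorm => // x xq; rewrite mul1r leNgt; apply/negP => hx.
by apply: h; exists x.
Qed.

Lemma quot_normD p q : (qnorm (p + q))%:C <= (qnorm p)%:C + (qnorm q)%:C :> R[i].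
Proof.
rewrite -rmorphD lecR; apply/ler_addgt0Pr => e e0.
have [x <- hx] := qnorm_near p (divr_gt0 e0 (ltr0Sn _ 1)).
have [y <- hy] := qnorm_near q (divr_gt0 e0 (ltr0Sn _ 1)).
rewrite -qpiD; apply: le_trans (qnorm_le _) _; apply: le_trans (rnormD _ _) _.
by apply: le_trans (lerD (ltW hx) (ltW hy)) _; lra.
Qed.

Lemma rnormZ (a : R[i]) (x : A) : rnorm (a *: x) = rnorm a * rnorm x.
Proof. by apply: complexI; rewrite rmorphM/= -!rnormE normrZ. Qed.

Lemma quot_normZ (a : R[i]) q : (qnorm (a *: q))%:C = `|a| * (qnorm q)%:C.
Proof.
have le b p : qnorm (b *: p) <= rnorm b * qnorm p.
  apply: le_qnorm => [|x <-]; first exact: rnorm_ge0.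
  by rewrite -qpiZ -rnormZ qnorm_le.
rewrite rnormE -rmorphM/=; congr (_ %:C); apply/eqP; rewrite eq_le le/=.
have [->|a0] := eqVneq a 0; first by rewrite rnorm0 mul0r qnorm_ge0.
have ap : 0 < rnorm a.
  by rewrite lt_def rnorm_ge0 andbT; apply: contra_neq a0 => /rnorm_eq0.
have := le (a^-1) (a *: q); rewrite scalerA (mulVf a0) scale1r.
have -> : rnorm (a^-1) = (rnorm a)^-1.
  apply: (mulfI (lt0r_neq0 ap)); rewrite -rnormM (mulfV a0) mulfV ?lt0r_neq0//.
  by rewrite (rnormC 1) normr1.
by rewrite ler_pdivlMl.
Qed.

Lemma quot_norm_eq0 q : (qnorm q)%:C = 0 :> R[i] -> q = 0.
Proof.
move=> /complexI q0; have [x xq] := qpi_surj q.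
rewrite -xq -qpi0; apply/qpi_eqP; rewrite subr0.
rewrite (closure_id (csi_set J)).1; last exact: csi_closed.
move=> B /nbhs_ballP[[e e'] /=]; rewrite ltcE /= => /andP[/eqP -> e0] xB.
have [y yq ye] := qnorm_near q e0.
exists (x - y); split; first by apply/qpi_eqP; rewrite xq yq.
apply: xB; rewrite -ball_normE /ball_ /= opprB addrC addrNK rnormE ltcR.
by rewrite q0 add0r in ye.
Qed.

HB.instance Definition _ := Lmodule_isNormed.Build R[i] quotalg
  quot_normD quot_normZ quot_norm_eq0.

Lemma qstarK : involutive qstar.
Proof. by move=> q; have [x <-] := qpi_surj q; rewrite -!qpi_star_sub starK. Qed.
Lemma qstarD : {morph qstar : p q / p + q}.
Proof.
move=> p q; have [x <-] := qpi_surj p; have [y <-] := qpi_surj q.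
by rewrite -qpiD -!qpi_star_sub starD qpiD.
Qed.
Lemma qstarZ (a : R[i]) q : qstar (a *: q) = a^*%C *: qstar q.
Proof.
by have [x <-] := qpi_surj q; rewrite -qpiZ -!qpi_star_sub starZ qpiZ.
Qed.
Lemma qstarM p q : qstar (qmul p q) = qmul (qstar q) (qstar p).
Proof.
have [x <-] := qpi_surj p; have [y <-] := qpi_surj q.
by rewrite -qpiM_sub -!qpi_star_sub starM qpiM_sub.
Qed.
Lemma quot_scalerAl (a : R[i]) (p q : quotalg) : a *: qmul p q = qmul (a *: p) q.
Proof.
have [x <-] := qpi_surj p; have [y <-] := qpi_surj q.
by rewrite -qpiM_sub -!qpiZ -qpiM_sub amulZl.
Qed.
Lemma quot_scalerAr (a : R[i]) (p q : quotalg) : a *: qmul p q = qmul p (a *: q).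
Proof.
have [x <-] := qpi_surj p; have [y <-] := qpi_surj q.
by rewrite -qpiM_sub -!qpiZ -qpiM_sub amulZr.
Qed.
Lemma quot_normM (p q : quotalg) : `|qmul p q| <= `|p| * `|q|.
Proof.
suff h : qnorm (qmul p q) <= qnorm p * qnorm q.
  by rewrite [leLHS]/((_)%:C) -rmorphM lecR.
apply: le_qnorm => [|y <-]; first exact: qnorm_ge0.
rewrite mulrC; apply: le_qnorm => [|x <-]; first exact: rnorm_ge0.
rewrite -qpiM_sub; apply: le_trans (qnorm_le _) _.
by rewrite -lecR rmorphM/= -!rnormE mulrC norm_amul.
Qed.
Lemma quot_norm_star (q : quotalg) : `|qstar q| = `|q|.
Proof.
have le p : qnorm (qstar p) <= qnorm p.
  rewrite -[leRHS]mul1r; apply: le_qnorm => // x <-.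
  rewrite -qpi_star_sub mul1r; apply: le_trans (qnorm_le _) _.
  by rewrite /rnorm norm_star.
suff h : qnorm (qstar q) = qnorm q by rewrite [LHS]/((_)%:C) h.
by apply/eqP; rewrite eq_le le -{1}(qstarK q) le.
Qed.

HB.instance Definition _ := isNormedStarAlgebra.Build R quotalg
  qmulA qmul1 qmulr1 qmulDl qmulDr quot_scalerAl quot_scalerAr
  qstarK qstarD qstarZ qstarM quot_normM quot_norm_star.

Lemma qpiM x y : qpi (x ** y) = qpi x ** qpi y.
Proof. exact: qpiM_sub. Qed.

Lemma qpi_star x : qpi (star x) = star (qpi x).
Proof. exact: qpi_star_sub. Qed.

End StarQuotient.

Section Dynamics.
Variables (R : realType) (A : normedStarAlgType R).
Implicit Types (phi : A -> R[i]) (sigma : R -> A -> A) (F : R[i] -> A).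

(* A positive linear functional of norm one.  The order of R[i] makes 0 <= z
   mean that z is real and nonnegative.  Since sup is 0 on sets that are not
   bounded above, the last clause also says that phi is bounded. *)
Definition is_state phi : Prop :=
  [/\ linear (phi : A -> R[i]^o),
      forall x, 0 <= phi (star x ** x) &
      sup [set rnorm (phi x) | x in [set x : A | rnorm x <= 1]] = 1].

(* Automorphisms are *-automorphisms; no isometry hypothesis is included. *)
Definition star_automorphism (f : A -> A) : Prop :=
  [/\ linear f, {morph f : x y / x ** y}, {morph f : x / star x} & bijective f].

(* A strongly continuous one-parameter group of *-automorphisms. *)
Definition is_dynamics sigma : Prop :=
  [/\ forall t, star_automorphism (sigma t),
      forall x, sigma 0 x = x,
      forall s t x, sigma (s + t) x = sigma s (sigma t x) &
      forall x, continuous (fun t => sigma t x)].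

(* F is given near every point by a norm-convergent power series. *)
Definition analytic_function F : Prop :=
  forall z0, exists c : nat -> A, exists2 r : R, 0 < r &
    forall h : R[i], rnorm h < r ->
      series (fun k => h ^+ k *: c k) @ \oo --> F (z0 + h).

Definition analytic_extension sigma (x : A) F : Prop :=
  analytic_function F /\ forall t : R, F t%:C = sigma t x.

Definition analytic_element sigma (x : A) : Prop :=
  exists F, analytic_extension sigma x F.

(* For analytic x, the element sigma_(i beta)(x) is F (i beta), where F is the
   (unique) analytic extension of t |-> sigma_t(x) to the complex plane. *)
Definition is_KMS sigma (beta : R) phi : Prop :=
  [/\ is_state phi,
      exists D : set A,
        [/\ dense D,
            forall t x, D x -> D (sigma t x),
            forall x, D x -> analytic_element sigma x &
            forall x y F, D x -> D y -> analytic_extension sigma x F ->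
              phi (x ** y) = phi (y ** F (0 +i* beta))] &
      beta = 0 ->
        (forall t x, phi (sigma t x) = phi x) /\
        (forall x y, phi (x ** y) = phi (y ** x))].

End Dynamics.

Section Shift.
Variables (R : realType) (I : choiceType) (p : I -> I) (p_inj : injective p).
Local Notation C := R[i].
Local Notation H := (ell2 R I).
Implicit Types u v : H.

Lemma hnorm2_esum u :
  (hnorm2 u)%:E = (\esum_(i in [set: I]) (rnorm (u i) ^+ 2)%:E)%E.
Proof.
have u0 i : 0 <= rnorm (u i) ^+ 2 by exact: sqr_ge0.
have le : (\esum_(i in [set: I]) (rnorm (u i) ^+ 2)%:E <= (hnorm2 u)%:E)%E.
  by apply: esum_le_psum => A; rewrite lee_fin psum_le_hnorm2.
have fn : (\esum_(i in [set: I]) (rnorm (u i) ^+ 2)%:E)%E \is a fin_num.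
  rewrite ge0_fin_numE; first exact: le_lt_trans le (ltry _).
  by apply: esum_ge0 => i _; rewrite lee_fin.
apply/eqP; rewrite eq_le le andbT -(fineK fn) lee_fin.
by apply: hnorm2_le => A; rewrite -lee_fin (fineK fn) psum_le_esum.
Qed.

(* The isometry e_h |-> e_(p h) for an injective p, see shift_basis. *)
Definition shift_fun (u : I -> C) : I -> C := fun k =>
  if pselect (exists h, p h = k) is left e then u (sval (cid e)) else 0.

Lemma shift_funE (u : I -> C) h : shift_fun u (p h) = u h.
Proof.
rewrite /shift_fun; case: pselect => [e|[]]; last by exists h.
by congr (u _); apply: p_inj; exact: (svalP (cid e)).
Qed.

Lemma shift_fun0 (u : I -> C) k : ~ (exists h, p h = k) -> shift_fun u k = 0.
Proof. by rewrite /shift_fun; case: pselect. Qed.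

Lemma esum_shift (u : I -> C) :
  (\esum_(i in [set: I]) (rnorm (shift_fun u i) ^+ 2)%:E =
   \esum_(i in [set: I]) (rnorm (u i) ^+ 2)%:E)%E.
Proof.
rewrite -[RHS](eq_esum (a := fun i => (rnorm (shift_fun u (p i)) ^+ 2)%:E)); last first.
  by move=> i _; rewrite shift_funE.
rewrite -(esum_image [set: I] p (fun k => (rnorm (shift_fun u k) ^+ 2)%:E)); last first.
  by move=> x y _ _; exact: p_inj.
rewrite [RHS]esum_mkcond; apply: eq_esum => k _; case: ifPn => // /negP.
rewrite inE => kp; rewrite shift_fun0 ?rnorm0 ?expr0n//.
by move=> [h hk]; apply: kp; exists h.
Qed.

Lemma shift_subproof u : shift_fun u \in @square_summable R I.
Proof. by rewrite unfold_in esum_shift; exact: ell2_fun_in. Qed.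

Definition shift_ell2 u : H := Ell2 (shift_subproof u).

Lemma hnorm_shift u : hnorm (shift_ell2 u) = hnorm u.
Proof.
rewrite /hnorm !innerE /=; congr Num.sqrt; apply: EFin_inj.
by rewrite !hnorm2_esum esum_shift.
Qed.

Lemma shift_in : shift_ell2 \in @bounded_op R I.
Proof.
apply/bounded_opP; split => [a u v|]; last first.
  by exists 1 => u; rewrite !rnorm_ell2 hnorm_shift mul1r.
apply: ell2E => k; rewrite ell2D ell2Z /= /shift_fun.
by case: pselect => // _; rewrite mulr0 addr0.
Qed.

Definition shift : bop R I := Bop shift_in.

Lemma shiftE u k : shift u k = shift_fun u k.
Proof. by []. Qed.

Lemma basisE (h k : I) : basis R h k = (k == h)%:R :> C.
Proof. by []. Qed.

Lemma shift_basis h : shift (basis R h) = basis R (p h).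
Proof.
apply: ell2E => k; rewrite shiftE basisE.
have [[j <-]|n] := pselect (exists j, p j = k).
  by rewrite shift_funE basisE (inj_eq p_inj).
rewrite shift_fun0//; case: eqP => // kp.
by exfalso; apply: n; exists h.
Qed.

End Shift.

Notation Nx := {a : nat | (0 < a)%N}.

(* The pair (a, m) stands for the element (a, m) of N^x |>< N. *)
Notation axN := (Nx * nat)%type.

Lemma Nx_mul_subproof (a b : Nx) : (0 < val a * val b)%N.
Proof. by rewrite muln_gt0 !valP. Qed.

Definition Nx_mul (a b : Nx) : Nx := 
  exist (fun c : nat => is_true (0 < c)%N) (val a * val b)%N (Nx_mul_subproof a b).

Definition Nx1 : Nx := exist (fun c : nat => is_true (0 < c)%N) 1%N (ltn0Sn 0).

Definition ax_mul (g h : axN) : axN :=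
  (Nx_mul g.1 h.1, (val h.1 * g.2 + h.2)%N).

Lemma ax_mul_inj g : injective (ax_mul g).
Proof.
move=> [b n] [b' n'] [] /= /eqP; rewrite eqn_pmul2l ?valP// => /eqP bb'.
by have -> : b = b' by [exact: val_inj]; move=> /addnI ->.
Qed.

Lemma ax_mul1 g : ax_mul (Nx1, 0%N) g = g.
Proof.
case: g => a m; rewrite /ax_mul /= muln0 add0n; congr (_, _).
by apply: val_inj; rewrite /= mul1n.
Qed.

Section ToeplitzAlgebra.
Variable R : realType.

Definition toeplitz_op (g : axN) : bop R axN := shift R (@ax_mul_inj g).

Lemma toeplitz_op_basis g h :
  toeplitz_op g (basis R h) = basis R (ax_mul g h).
Proof. exact: shift_basis. Qed.

Definition toeplitz_set : set (bop R axN) := cstar_gen (range toeplitz_op).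

Lemma toeplitz_op_in g : toeplitz_set (toeplitz_op g).
Proof. by apply: sub_gen_smallest; exists g. Qed.

Lemma toeplitz_op1 : toeplitz_op (Nx1, 0%N) = aone.
Proof.
apply: bopE => u; apply: ell2E => k.
by rewrite shiftE -[in LHS](ax_mul1 k) shift_funE//; exact: ax_mul_inj.
Qed.

Lemma toeplitz_one : toeplitz_set aone.
Proof. by rewrite -toeplitz_op1; exact: toeplitz_op_in. Qed.

Definition toeplitz_sub : unital_star_subalgebra (bop R axN) :=
  UnitalStarSubalgebra (cstar_gen_subalgebra (range toeplitz_op)) toeplitz_one.

Definition toeplitz : Type := subalg toeplitz_sub.

HB.instance Definition _ := NormedStarAlgebra.on toeplitz.

Definition toeplitz_gen (g : axN) : toeplitz :=
  @Subalg _ _ toeplitz_sub (toeplitz_op g)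
    (introT (uss_predP toeplitz_sub _) (toeplitz_op_in g)).

Definition genS : toeplitz := toeplitz_gen (Nx1, 1%N).

Definition genV (a : Nx) : toeplitz := toeplitz_gen (a, 0%N).

(* 1 - S S^* *)
Definition add_relation : toeplitz := aone - genS ** star genS.

Lemma add_relation_star x : [set add_relation] x -> [set add_relation] (star x).
Proof.
move=> ->; rewrite /add_relation /= starD starN starM starK; congr (_ - _).
by rewrite -[LHS]amul1r -[X in _ ** X]starK -starM amul1r starK.
Qed.

Definition add_ideal : closed_star_ideal toeplitz :=
  ClosedStarIdeal (closed_ideal_gen_ideal [set add_relation])
    (@closed_ideal_gen_closed _ _ [set add_relation])
    (closed_ideal_gen_star add_relation_star).

Definition add_boundary : Type := quotalg add_ideal.

HB.instance Definition _ := NormedStarAlgebra.on add_boundary.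

Definition add_boundary_map : toeplitz -> add_boundary := qpi add_ideal.

(* a^(it) = exp (i t ln a), for a > 0. *)
Definition natpow_i (a : nat) (t : R) : R[i] :=
  cos (t * ln a%:R) +i* sin (t * ln a%:R).

End ToeplitzAlgebra.

(* Main.v *)
(* If S is fixed by the dynamics, every KMS state phi satisfies phi (S y) =
   phi (y S): take x near S in the set D of analytic elements given by the KMS
   condition, with analytic extension F.  Averages of sigma_t (F (i beta)) over
   suitable finite sets of times t are close to the same averages of sigma_t x,
   hence to S, because the derivative of F along the imaginary axis is i times
   the infinitesimal generator, which averaging annihilates; averaging the KMS
   identity phi (sigma_t x y) = phi (y sigma_t (F (i beta))) then gives the claim.
   This replaces the three-lines argument, which would need Cauchy's theorem.
   The averages are controlled since *-automorphisms of the Toeplitz algebra are contractive, a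
   consequence of the existence of square roots of 1 - h for |h| < 1.

   Thus phi (S S^* ) = phi (S^* S) = 1, so phi (P) = 0 for the projection
   P = 1 - S S^*.  By Cauchy-Schwarz phi (P w) = 0 for all w, and the KMS
   condition turns phi (u P v) into some phi (P v F(i beta)) = 0 for u in D, so phi
   vanishes on the ideal generated by P. *)
Require Import Defs.
From HB Require Import structures.
From mathcomp Require Import all_boot all_order all_algebra finmap.
From mathcomp Require Import all_classical all_reals all_analysis.
From mathcomp Require Import complex.
From mathcomp.analysis.showcase Require Import summability.
From mathcomp Require Import ring lra.
Set Implicit Arguments. Unset Strict Implicit. Unset Printing Implicit Defensive.
Import Order.TTheory GRing.Theory Num.Theory.
Import numFieldNormedType.Exports.
Local Open Scope classical_set_scope.
Local Open Scope ring_scope.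
Local Open Scope complex_scope.

(** * Norms and power series *)

Section RealNormZmodule.
Variables (R : realType) (V : normedZmodType R[i]).
Implicit Types x y : V.

Lemma rnormN x : rnorm (- x) = rnorm x.
Proof. by rewrite /rnorm normrN. Qed.

Lemma rnormB x y : rnorm (x - y) = rnorm (y - x).
Proof. by rewrite -rnormN opprB. Qed.

Lemma rnorm_gt0 x : x != 0 -> 0 < rnorm x.
Proof. by move=> x0; rewrite lt_def rnorm_ge0 andbT; apply: contra_neq x0 => /rnorm_eq0. Qed.

Lemma rnorm_sum (I : Type) (s : seq I) (f : I -> V) :
  rnorm (\sum_(i <- s) f i) <= \sum_(i <- s) rnorm (f i).
Proof.
elim/big_ind2 : _ => [|x b y c xb yc|//]; first by rewrite rnorm0.
exact: le_trans (rnormD _ _) (lerD xb yc).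
Qed.

Lemma rnorm_eq0_eps x : (forall e : R, 0 < e -> rnorm x <= e) -> x = 0.
Proof.
move=> h; apply: rnorm_eq0; apply/eqP; rewrite eq_le rnorm_ge0 andbT.
by apply/ler_addgt0Pr => e e0; rewrite add0r; exact: h.
Qed.

End RealNormZmodule.

Lemma rnormX (R : realType) (a : R[i]) n : rnorm (a ^+ n) = rnorm a ^+ n.
Proof. by apply: complexI; rewrite rmorphXn/= -!rnormE normrX. Qed.

Lemma rnorm_i (R : realType) (s : R) : rnorm (0 +i* s : R[i]) = `|s|.
Proof. by rewrite /rnorm normc_def/= expr0n add0r sqrtr_sqr. Qed.

Section RealNorm.
Variables (R : realType) (V : normedModType R[i]).
Implicit Types (x y : V) (a : R[i]).

Lemma rnorm_scale a x : rnorm (a *: x) = rnorm a * rnorm x.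
Proof. by apply: complexI; rewrite rmorphM/= -!rnormE normrZ. Qed.

Lemma cvg_rnormP (T : Type) (F : set_system T) (FF : Filter F) (f : T -> V) l :
  f @ F --> l <-> forall e : R, 0 < e -> \forall t \near F, rnorm (l - f t) < e.
Proof.
split=> [/cvgrPdist_lt fl e e0|fl].
  have /fl : 0 < e%:C by rewrite ltcR.
  by apply: filterS => t; rewrite rnormE ltcR.
apply/cvgrPdist_lt => -[e e']; rewrite ltcE /= => /andP[/eqP -> e0].
by apply: filterS (fl _ e0) => t; rewrite rnormE ltcR.
Qed.

Lemma dense_rnorm (D : set V) x (e : R) : dense D -> 0 < e ->
  exists2 d, D d & rnorm (x - d) < e.
Proof.
move=> Dd e0.
have e0' : 0 < e%:C by rewrite ltcR.
have [|d [bd Dd']] := Dd (ball x e%:C) _ (ball_open x e%:C).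
  by exists x; exact: ballxx.
by exists d => //; move: bd; rewrite -ball_normE /ball_ /= rnormE ltcR.
Qed.

Lemma closed_rnorm (B : set V) x : closed B ->
  (forall e : R, 0 < e -> exists2 y, B y & rnorm (x - y) < e) -> B x.
Proof.
move=> Bc h; rewrite (closure_id B).1// => W /nbhs_ballP[[e e'] /=].
rewrite ltcE /= => /andP[/eqP -> e0] xW.
have [y By xy] := h _ e0; exists y; split => //; apply: xW.
by rewrite -ball_normE /ball_ /= rnormE ltcR.
Qed.

Lemma closed_from_rnorm (B : set V) :
  (forall x, (forall e : R, 0 < e -> exists2 y, B y & rnorm (x - y) < e) -> B x) ->
  closed B.
Proof.
move=> h x xB; apply: h => e e0.
have e0' : 0 < e%:C by rewrite ltcR.
have [y [By]] := xB _ (nbhsx_ballx x _ e0').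
by rewrite -ball_normE /ball_ /= rnormE ltcR => xy; exists y.
Qed.

End RealNorm.

(** * Vector-valued power series: remainders and accumulating zeros *)

Section PowerSeries.
Variables (R : realType) (V : normedModType R[i]).
Implicit Types (c : nat -> V) (G : R[i] -> V) (r : R).

Definition power_series_at c (r : R) G : Prop :=
  forall h : R[i], rnorm h < r -> series (fun k => h ^+ k *: c k) @ \oo --> G h.

Lemma cvg_seq_rnorm (u : nat -> V) l (e : R) : u @ \oo --> l -> 0 < e ->
  exists N, forall n, (N <= n)%N -> rnorm (l - u n) < e.
Proof.
move=> /cvg_rnormP ul e0; have [N _ NP] := ul _ e0.
by exists N => n Nn; exact: NP.
Qed.

(** At the point [r / 2] each term is a difference of consecutive remainders, so all but finitely
    many terms have norm at most 2; [M] adds the norms of the others. *)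
Lemma power_series_coef_bound c r G : 0 < r -> power_series_at c r G ->
  exists2 M : R, 0 <= M & forall k, rnorm (c k) * (r / 2) ^+ k <= M.
Proof.
move=> r0 cG.
have hr : rnorm ((r / 2)%:C : R[i]) = r / 2 by rewrite rnormC ger0_norm// divr_ge0// ltW.
have hlt : rnorm ((r / 2)%:C : R[i]) < r by rewrite hr; lra.
have [N NP] := cvg_seq_rnorm (cG _ hlt) ltr01.
pose t k := rnorm (c k) * (r / 2) ^+ k.
have t0 k : 0 <= t k by rewrite mulr_ge0 ?rnorm_ge0// exprn_ge0// divr_ge0// ltW.
have tE k : t k = rnorm (((r / 2)%:C : R[i]) ^+ k *: c k).
  by rewrite rnorm_scale rnormX hr mulrC.
have big k : (N <= k)%N -> t k <= 2.
  move=> Nk; rewrite tE.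
  have -> : ((r / 2)%:C : R[i]) ^+ k *: c k =
     (G (r / 2)%:C - series (fun k => ((r / 2)%:C : R[i]) ^+ k *: c k) k)
     - (G (r / 2)%:C - series (fun k => ((r / 2)%:C : R[i]) ^+ k *: c k) k.+1).
    by rewrite seriesSr opprB addrC addrA addrNK addrC addKr.
  apply: le_trans (rnormD _ _) _; rewrite rnormN.
  have := NP _ Nk; have := NP _ (leqW Nk); lra.
exists (2 + \sum_(k < N) t k) => [|k].
  by rewrite addr_ge0 ?sumr_ge0.
have [kN|/big] := ltnP k N.
  rewrite -/(t k) (bigD1 (Ordinal kN))//= addrCA lerDl addr_ge0// sumr_ge0//.
by move/le_trans; apply; rewrite lerDl sumr_ge0.
Qed.

(** Domination by a geometric series: for [rnorm h < r / 4] the ratio [q] is at most 1/2, so the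
    tail from rank [n] is at most [2 * M * q ^+ n]. *)
Lemma power_series_tail c r G n : 0 < r -> power_series_at c r G ->
  exists rho : R, exists K : R, [/\ 0 < rho, 0 <= K & forall h : R[i], rnorm h < rho ->
    rnorm (G h - \sum_(k < n) h ^+ k *: c k) <= K * rnorm h ^+ n].
Proof.
move=> r0 cG; have [M M0 cM] := power_series_coef_bound r0 cG.
pose b := r / 2; have b0 : 0 < b by rewrite divr_gt0.
exists (r / 4), (2 * M / b ^+ n); split.
- by rewrite divr_gt0.
- by rewrite divr_ge0 ?exprn_ge0 ?mulr_ge0// ltW.
move=> h hr; have hr' : rnorm h < r by lra.
pose q := rnorm h / b.
have q0 : 0 <= q by rewrite divr_ge0 ?rnorm_ge0// ltW.
have q2 : q <= 1 / 2 by rewrite /q ler_pdivrMr// /b; lra.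
have tm k : rnorm (h ^+ k *: c k) <= M * q ^+ k.
  rewrite rnorm_scale rnormX.
  have -> : rnorm h ^+ k = q ^+ k * b ^+ k by rewrite -exprMn /q divfK// lt0r_neq0.
  by rewrite -mulrA [M * _]mulrC ler_wpM2l ?exprn_ge0// mulrC cM.
have psum m : rnorm (\sum_(n <= k < n + m) h ^+ k *: c k) <= 2 * M * q ^+ n.
  (* The factor [1 - q ^+ m] makes the induction on [m] close, since [q <= 1 / 2]. *)
  apply: (@le_trans _ _ (2 * M * q ^+ n * (1 - q ^+ m))); last first.
    rewrite ler_piMr ?mulr_ge0 ?exprn_ge0//.
    by rewrite gerBl exprn_ge0.
  elim: m => [|m IH]; first by rewrite addn0 big_geq// rnorm0 expr0 subrr mulr0.
  rewrite addnS big_nat_recr ?leq_addr//=.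
  apply: le_trans (rnormD _ _) _; apply: le_trans (lerD IH (tm _)) _.
  rewrite exprD -subr_ge0 exprS.
  rewrite [X in 0 <= X](_ : _ = M * q ^+ n * q ^+ m * (1 - 2 * q)); last by ring.
  by rewrite mulr_ge0 ?mulr_ge0 ?exprn_ge0//; lra.
have -> : 2 * M / b ^+ n * rnorm h ^+ n = 2 * M * q ^+ n.
  by rewrite [q ^+ n]expr_div_n mulrAC mulrA.
apply/ler_addgt0Pr => e e0.
have [N NP] := cvg_seq_rnorm (cG _ hr') e0.
have := NP (n + N)%N (leq_addl _ _).
rewrite seriesEnat /= (big_cat_nat (n := n))// ?leq_addr//= big_mkord.
move: (psum N); set X := \sum_(n <= k < _) _; set Y := \sum_(k < n) _ => hX hY.
rewrite (_ : G h - Y = X + (G h - (Y + X))).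
  by apply: le_trans (rnormD _ _) _; rewrite lerD// ltW.
by rewrite addrCA opprD [X + _]addrC addrNK.
Qed.

(** If the coefficients below [k] vanish, the remainder of order [k.+1] at a zero [h] bounds
    [rnorm (c k)] by [K * rnorm h], and [h] can be taken arbitrarily small. *)
Lemma power_series_coef0 c r G : 0 < r -> power_series_at c r G ->
  (forall d : R, 0 < d -> exists h : R[i], [/\ h != 0, rnorm h < d & G h = 0]) ->
  forall k, c k = 0.
Proof.
move=> r0 cG zG; elim/ltn_ind => k IH.
have [rho [K [rho0 K0 tail]]] := power_series_tail k.+1 r0 cG.
apply: rnorm_eq0_eps => e e0.
have K1 : 0 < K + 1 by lra.
have d0 : 0 < Num.min rho (e / (K + 1)) by rewrite lt_min rho0 divr_gt0.
have [h [h0 hd Gh]] := zG _ d0.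
move: hd; rewrite lt_min => /andP[hrho he].
have := tail _ hrho; rewrite Gh sub0r rnormN big_ord_recr/= big1 ?add0r; last first.
  by move=> j _; rewrite IH ?scaler0.
have hp := rnorm_gt0 h0.
rewrite rnorm_scale rnormX exprSr mulrA [X in _ <= X]mulrAC [X in _ <= X]mulrC.
rewrite ler_pM2l ?exprn_gt0// => /le_trans; apply.
move: he; rewrite ltr_pdivlMr// => he; apply: le_trans (ltW he).
by rewrite mulrC ler_wpM2l ?rnorm_ge0//; lra.
Qed.

Lemma power_series_zero c r G : (forall k, c k = 0) -> power_series_at c r G ->
  forall h, rnorm h < r -> G h = 0.
Proof.
move=> c0 cG h hr; apply: rnorm_eq0_eps => e e0.
have [N NP] := cvg_seq_rnorm (cG _ hr) e0.
have := NP N (leqnn N); rewrite seriesEnat /= big1 ?subr0; last first.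
  by move=> k _; rewrite c0 scaler0.
exact: ltW.
Qed.

End PowerSeries.

(** The difference quotients at [a] are O(h), so the derivative vanishes everywhere. Applied to an
    indicator function, this is a connectedness argument for the real line. *)
Lemma quadratically_flat_cst (R : realType) (q : R -> R) :
  (forall a, exists K d : R, 0 < d /\ forall h, `|h| < d -> `|q (a + h) - q a| <= K * h ^+ 2) ->
  forall x y, q x = q y.
Proof.
move=> flat x y; apply: is_derive_0_is_cst => a.
have [K [d [d0 qK]]] := flat a.
suff dq : (fun h : R => h^-1 *: ((q \o shift a) (h *: (1 : R)) - q a)) @ 0^' --> (0 : R).
  by apply: DeriveDef; [exact: cvgP dq|exact: norm_cvg_lim dq].
apply/cvgrPdist_lt => e e0; near=> h.
have h0 : h != 0 by near: h; exact: nbhs_dnbhs_neq.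
have hd : `|h| < Num.min d (e / (`|K| + 1)).
  near: h; apply: dnbhs0_lt.
  by rewrite lt_min d0 divr_gt0// ltr_pwDr.
move: hd; rewrite lt_min => /andP[hd].
rewrite ltr_pdivlMr ?ltr_pwDr// => he.
rewrite sub0r normrN normrZ normfV /= [h *: 1]mulr1 [h + a]addrC.
rewrite ltr_pdivrMl ?normr_gt0//; apply: le_lt_trans (qK _ hd) _.
rewrite -normr_gt0 in h0.
apply: le_lt_trans (_ : `|h| * (`|h| * `|K|) < _); last first.
  rewrite ltr_pM2l//; apply: le_lt_trans he.
  by rewrite ler_wpM2l// lerDl.
by rewrite mulrA -expr2 real_normK ?num_real// mulrC ler_wpM2l ?sqr_ge0// ler_norm.
Unshelve. all: by end_near. Qed.

(** * The identity theorem and first-order expansions *)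

Section AnalyticFunctions.
Variables (R : realType) (A : normedStarAlgType R).
Implicit Types (F : R[i] -> A) (z h : R[i]).

(** Identity theorem along the vertical line through the real point [a]: the heights [s] near which
    [F] vanishes form an open and closed set containing 0. *)
Lemma analytic_zero F : analytic_function F -> (forall t : R, F t%:C = 0) ->
  forall z, F z = 0.
Proof.
move=> Fa F0 [a b].
pose van (s : R) := exists2 d : R, 0 < d & forall h, rnorm h < d -> F ((a +i* s) + h) = 0.
have acc s : (forall d : R, 0 < d ->
    exists h, [/\ h != 0, rnorm h < d & F ((a +i* s) + h) = 0]) -> van s.
  move=> zF; have [c [r r0 cF]] := Fa (a +i* s).
  have cF' : power_series_at c r (fun h => F ((a +i* s) + h)) by exact: cF.
  by exists r => //; exact: power_series_zero (power_series_coef0 r0 cF' zF) cF'.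
(* The real zeros [a + d / 2] accumulate at [a]. *)
have van0 : van 0.
  apply: acc => d d0; exists (d / 2)%:C; split.
  - by rewrite eq_complex /= eqxx andbT gt_eqF// divr_gt0.
  - by rewrite rnormC gtr0_norm ?divr_gt0//; lra.
  - by rewrite -[RHS](F0 (a + d / 2)); congr F; apply/eqP; rewrite eq_complex /= addr0 !eqxx.
have iD (s u : R) : (a +i* (s + u)) = (a +i* s) + (0 +i* u) :> R[i].
  by apply/eqP; rewrite eq_complex /= addr0 !eqxx.
(* The indicator of [van] is locally constant, hence flat with [K = 0]. If it took the value 1
   arbitrarily close to a point outside [van], zeros would accumulate there and [acc] would
   apply. *)
have /quadratically_flat_cst flat : forall s : R, exists K d : R, 0 < d /\ forall u, `|u| < d ->
    `|(`[< van (s + u) >]%:R : R) - `[< van s >]%:R| <= K * u ^+ 2.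
  move=> s; exists 0; have [vs|nvs] := pselect (van s).
    have [d d0 dF] := vs; exists (d / 2); split => [|h hd]; first by rewrite divr_gt0.
    rewrite (asboolT vs) asboolT ?subrr ?normr0 ?mul0r//.
    exists (d / 2); first by rewrite divr_gt0.
    move=> k kd; rewrite iD -addrA; apply: dF.
    by apply: le_lt_trans (rnormD _ _) _; rewrite rnorm_i; lra.
  apply: contrapT => nd; apply: (nvs); apply: acc => d d0.
  apply: contrapT => nh; apply: nd; exists d; split => // h hd.
  rewrite mul0r; have [->|h0] := eqVneq h 0; first by rewrite addr0 subrr normr0.
  rewrite !asboolF ?subrr ?normr0// => -[d' d'0 dF]; apply: nh.
  exists (0 +i* h); split.
  - by rewrite eq_complex /= eqxx.
  - by rewrite rnorm_i.
  - by rewrite -iD -[X in F X]addr0 dF// rnorm0.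
have := flat 0 b; rewrite (asboolT van0); case: asboolP => [[d d0 dF] _|_ /eqP].
  by rewrite -[X in F X]addr0; apply: dF; rewrite rnorm0.
by rewrite oner_eq0.
Qed.

Lemma analytic_sub F G : analytic_function F -> analytic_function G ->
  analytic_function (fun z => F z - G z).
Proof.
move=> Fa Ga z; have [c [r r0 cF]] := Fa z; have [d [s s0 dG]] := Ga z.
exists (fun k => c k - d k), (Num.min r s); first by rewrite lt_min r0.
move=> h; rewrite lt_min => /andP[hr hs].
refine (eq_cvg_to _ (cvgB (cF _ hr) (dG _ hs))) => n.
by rewrite /= fctE !seriesEnat /= -sumrB; apply: eq_bigr => k _; rewrite scalerBr.
Qed.

Lemma analytic_shift F a : analytic_function F -> analytic_function (fun z => F (z + a)).
Proof.
move=> Fa z; have [c [r r0 cF]] := Fa (z + a); exists c, r => // h hr.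
by rewrite addrAC; exact: cF.
Qed.

Lemma analytic_contraction (f : A -> A) F : linear f ->
  (forall x, rnorm (f x) <= rnorm x) -> analytic_function F ->
  analytic_function (fun z => f (F z)).
Proof.
move=> fl fc Fa z; pose fL : {linear A -> A} := HB.pack f (GRing.isLinear.Build _ _ _ _ f fl).
have [c [r r0 cF]] := Fa z; exists (fun k => f (c k)), r => // h hr.
apply/cvg_rnormP => e e0; have /cvg_rnormP/(_ _ e0) := cF _ hr.
apply: filterS => n; apply: le_lt_trans.
rewrite !seriesEnat /=; set u := \sum_(0 <= k < n) h ^+ k *: c k.
have -> : \sum_(0 <= k < n) h ^+ k *: f (c k) = fL u.
  by rewrite linear_sum; apply: eq_bigr => k _; rewrite linearZ.
by have -> : f (F (z + h)) - fL u = f (F (z + h) - u) by rewrite -[f]/(fL : A -> A) linearB.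
Qed.

(** The remainder estimate of order 2, with [x] the derivative at [z]; its case [h = 0] identifies
    the constant coefficient with [F z]. *)
Lemma analytic_first_order F z : analytic_function F ->
  exists (x : A) (K d : R), 0 < d /\ forall h, rnorm h < d ->
    rnorm (F (z + h) - F z - h *: x) <= K * rnorm h ^+ 2.
Proof.
move=> Fa; have [c [r r0 cF]] := Fa z.
have cF' : power_series_at c r (fun h => F (z + h)) by exact: cF.
have [d [K [d0 _ tail]]] := power_series_tail 2 r0 cF'.
have F0 : F z = c 0%N.
  apply/eqP; rewrite -subr_eq0; apply/eqP/rnorm_eq0/eqP; rewrite eq_le rnorm_ge0 andbT.
  have := tail 0; rewrite rnorm0 addr0 !big_ord_recl big_ord0 /= expr0 scale1r.
  by rewrite expr1 scale0r !addr0 expr0n/= mulr0; apply.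
exists (c 1%N), K, d; split => // h /tail.
by rewrite !big_ord_recl big_ord0 /= expr0 scale1r addr0 F0 opprD addrA.
Qed.

End AnalyticFunctions.

(** * Analytic elements of a contractive group *)

(* [orbit_dist x] is the distance from 0 to the convex hull of the orbit of [x].
   The group being abelian, it is a seminorm, and it kills [sigma t x - x]. *)
Section OrbitMean.
Variables (R : realType) (A : normedStarAlgType R) (sigma : R -> A -> A).
Hypothesis sigma_linear : forall t, linear (sigma t).
Hypothesis sigma_contr : forall t x, rnorm (sigma t x) <= rnorm x.
Hypothesis sigma0 : forall x, sigma 0 x = x.
Hypothesis sigmaD : forall s t x, sigma (s + t) x = sigma s (sigma t x).
Implicit Types (s r : seq R) (x y : A) (t : R) (F : R[i] -> A).

Let sigmaL t : {linear A -> A} :=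
  HB.pack (sigma t) (GRing.isLinear.Build _ _ _ _ (sigma t) (sigma_linear t)).

(** Times form a list with repetitions, so that a composite of means is again a mean. The empty list
    gives 0, hence its exclusion in [orbit_dist]. *)
Definition orbit_mean s x : A := ((size s)%:R^-1 : R)%:C *: \sum_(t <- s) sigma t x.

Lemma orbit_meanN s x : orbit_mean s (- x) = - orbit_mean s x.
Proof.
rewrite /orbit_mean -scalerN -sumrN; congr (_ *: _); apply: eq_bigr => t _.
exact: (linearN (sigmaL t)).
Qed.

Lemma orbit_meanD s x y : orbit_mean s (x + y) = orbit_mean s x + orbit_mean s y.
Proof.
rewrite /orbit_mean -scalerDr -big_split/=; congr (_ *: _); apply: eq_bigr => t _.
exact: (linearD (sigmaL t)).
Qed.

Lemma orbit_meanB s x y : orbit_mean s (x - y) = orbit_mean s x - orbit_mean s y.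
Proof. by rewrite orbit_meanD orbit_meanN. Qed.

Lemma rnorm_orbit_mean s x : rnorm (orbit_mean s x) <= rnorm x.
Proof.
rewrite /orbit_mean rnorm_scale rnormC ger0_norm ?invr_ge0//.
have [->|s0] := eqVneq (size s) 0%N; first by rewrite invr0 mul0r rnorm_ge0.
rewrite ler_pdivrMl ?ltr0n ?lt0n//; apply: le_trans (rnorm_sum _ _) _.
rewrite -sum1_size natr_sum mulr_suml; apply: ler_sum => t _.
by rewrite mul1r.
Qed.

Lemma orbit_mean_comp s r x :
  orbit_mean s (orbit_mean r x) = orbit_mean [seq t + u | t <- s, u <- r] x.
Proof.
rewrite /orbit_mean size_allpairs natrM invfM rmorphM/= -scalerA; congr (_ *: _).
rewrite big_allpairs_dep [RHS]scaler_sumr; apply: eq_bigr => t _.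
rewrite -[sigma t]/(sigmaL t : A -> A) linearZ linear_sum; congr (_ *: _).
by apply: eq_bigr => u _; rewrite sigmaD.
Qed.

Lemma orbit_mean_comm s r x :
  orbit_mean s (orbit_mean r x) = orbit_mean r (orbit_mean s x).
Proof.
rewrite !orbit_mean_comp /orbit_mean !size_allpairs mulnC; congr (_ *: _).
rewrite !big_allpairs_dep exchange_big; apply: eq_bigr => t _; apply: eq_bigr => u _.
by rewrite addrC.
Qed.

Definition orbit_dist x : R := inf [set rnorm (orbit_mean s x) | s in [set s | s != [::]]].

Lemma orbit_dist_le s x : s != [::] -> orbit_dist x <= rnorm (orbit_mean s x).
Proof.
by move=> s0; apply: ge_inf; [exists 0 => _ [r _ <-]; exact: rnorm_ge0|exists s].
Qed.

Lemma orbit_dist_near x (e : R) : 0 < e ->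
  exists2 s, s != [::] & rnorm (orbit_mean s x) < orbit_dist x + e.
Proof.
move=> e0; have [|_ [s s0 <-] h] := inf_adherent e0
  (E := [set rnorm (orbit_mean s x) | s in [set s | s != [::]]]).
  split; first by exists (rnorm (orbit_mean [:: 0] x)), [:: 0].
  by exists 0 => _ [r _ <-]; exact: rnorm_ge0.
by exists s.
Qed.

Lemma orbit_dist_ge0 x : 0 <= orbit_dist x.
Proof.
apply: lb_le_inf; first by exists (rnorm (orbit_mean [:: 0] x)), [:: 0].
by move=> _ [r _ <-]; exact: rnorm_ge0.
Qed.

Lemma orbit_dist_rnorm x : orbit_dist x <= rnorm x.
Proof. exact: le_trans (@orbit_dist_le [:: 0] x isT) (rnorm_orbit_mean _ _). Qed.

Lemma orbit_distN x : orbit_dist (- x) = orbit_dist x.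
Proof.
by congr inf; apply: eq_imagel => s _; rewrite orbit_meanN rnormN.
Qed.

(** If [s] is good for [x] and [r] for [y], the composite mean is good for both, since means commute
    and contract. *)
Lemma orbit_distD x y : orbit_dist (x + y) <= orbit_dist x + orbit_dist y.
Proof.
apply/ler_addgt0Pr => e e0; have e20 : 0 < e / 2 by rewrite divr_gt0.
have [s s0 sx] := orbit_dist_near x e20.
have [r r0 ry] := orbit_dist_near y e20.
have l0 : [seq t + u | t <- s, u <- r] != [::].
  by rewrite -size_eq0 size_allpairs muln_eq0 !size_eq0 negb_or s0.
apply: le_trans (orbit_dist_le _ l0) _.
rewrite -orbit_mean_comp !orbit_meanD (orbit_mean_comm s r x).
apply: le_trans (rnormD _ _) _.
have := rnorm_orbit_mean r (orbit_mean s x).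
have := rnorm_orbit_mean s (orbit_mean r y).
lra.
Qed.

Lemma orbit_dist_sub x y : orbit_dist x - orbit_dist y <= orbit_dist (x - y).
Proof. by rewrite lerBlDr -{1}[x](subrK y) orbit_distD. Qed.

(** The mean over the times [t *+ k] with [k < N] telescopes to [sigma (t *+ N) x - x] divided by
    [N], of norm at most [2 * rnorm x / N]. *)
Lemma orbit_dist_shift t x : orbit_dist (sigma t x - x) = 0.
Proof.
apply/eqP; rewrite eq_le orbit_dist_ge0 andbT.
apply/ler_addgt0Pr => e e0; rewrite add0r.
have M0 : 0 <= 2 * rnorm x / e by rewrite divr_ge0 ?mulr_ge0 ?rnorm_ge0// ltW.
set N := Num.bound (2 * rnorm x / e).
have NP : 2 * rnorm x / e < N%:R by exact: archi_boundP.
have N0 : (0 < N)%N by rewrite -(ltr0n R); exact: le_lt_trans M0 NP.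
pose s := [seq t *+ k | k <- iota 0 N].
have s0 : s != [::] by rewrite -size_eq0 size_map size_iota -lt0n.
apply: le_trans (orbit_dist_le _ s0) _.
rewrite /orbit_mean size_map size_iota big_map.
have -> : \sum_(k <- iota 0 N) sigma (t *+ k) (sigma t x - x) = sigma (t *+ N) x - x.
  transitivity (\sum_(0 <= k < N) (sigma (t *+ k.+1) x - sigma (t *+ k) x)).
    rewrite /index_iota subn0; apply: eq_bigr => k _.
    by rewrite -[LHS]/(sigmaL _ _) linearB /= -sigmaD -mulrSr.
  by rewrite telescope_sumr// mulr0n sigma0.
rewrite rnorm_scale rnormC ger0_norm ?invr_ge0// ler_pdivrMl ?ltr0n//.
have h2 : rnorm (sigma (t *+ N) x - x) <= 2 * rnorm x.
  apply: le_trans (rnormD _ _) _; rewrite rnormN.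
  by have := sigma_contr (t *+ N) x; lra.
by apply: le_trans h2 _; move: NP; rewrite ltr_pdivrMr// => /ltW.
Qed.

(** Both sides are analytic in [z] and agree at real points by the group law, so the identity
    theorem applies. *)
Lemma analytic_extension_shift x F : analytic_extension sigma x F ->
  forall t z, F (z + t%:C) = sigma t (F z).
Proof.
move=> [Fa Fx] t z; apply/eqP; rewrite -subr_eq0; apply/eqP; move: z.
apply: analytic_zero.
  apply: analytic_sub; first exact: analytic_shift.
  exact: analytic_contraction.
by move=> u; rewrite -rmorphD !Fx [u + t]addrC sigmaD subrr.
Qed.

Lemma analytic_extension_orbit x F (t : R) : analytic_extension sigma x F ->
  analytic_extension sigma (sigma t x) (fun z => F (z + t%:C)).
Proof.
move=> [Fa Fx]; split; first exact: analytic_shift.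
by move=> u; rewrite -rmorphD Fx sigmaD.
Qed.

(* Modulo elements killed by [orbit_dist] a purely imaginary increment of [F] is
   [i] times a real one, and the latter is of the form [sigma t y - y]; so the
   function [b |-> orbit_dist (F (i b) - x)] has derivative zero. *)
Lemma orbit_dist_analytic x F (b : R) : analytic_extension sigma x F ->
  orbit_dist (F (0 +i* b) - x) = 0.
Proof.
move=> Fext; have [Fa Fx] := Fext.
have F0 : F (0 +i* 0) = x by rewrite -[RHS]sigma0 -Fx.
have h0 : orbit_dist (F (0 +i* 0) - x) = 0.
  by rewrite F0 -[X in X - _]sigma0 orbit_dist_shift.
apply: etrans h0; apply: (@quadratically_flat_cst _ (fun b => orbit_dist (F (0 +i* b) - x))).
move=> {b} a.
have [y [K [d [d0 Fd]]]] := analytic_first_order (0 +i* a) Fa.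
exists (2 * K), d; split => // h hd.
suff le : orbit_dist (F (0 +i* (a + h)) - F (0 +i* a)) <= 2 * K * h ^+ 2.
  rewrite ler_norml; apply/andP; split.
    rewrite lerNl opprB. apply: le_trans (orbit_dist_sub _ _) _.
    by rewrite opprB addrA subrK -orbit_distN opprB.
  apply: le_trans (orbit_dist_sub _ _) _.
  by rewrite opprB addrA subrK.
have E1 := Fd (0 +i* h); have E2 := Fd h%:C.
rewrite rnorm_i in E1; rewrite rnormC in E2.
have iE : (0 +i* (a + h)) = (0 +i* a) + (0 +i* h) :> R[i].
  by apply/eqP; rewrite eq_complex /= addr0 !eqxx.
(* The first-order terms cancel because ['i * h%:C = 0 +i* h]. What is left are two second-order
   remainders, which give the constant [2 * K], and a term killed by [orbit_dist_shift]. *)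
rewrite iE (_ : _ - _ = ((F (0 +i* a + (0 +i* h)) - F (0 +i* a) - (0 +i* h) *: y)
   - 'i *: (F (0 +i* a + h%:C) - F (0 +i* a) - h%:C *: y))
   + (sigma h ('i *: F (0 +i* a)) - 'i *: F (0 +i* a))); last first.
  rewrite (analytic_extension_shift Fext).
  have -> : sigma h ('i *: F (0 +i* a)) = 'i *: sigma h (F (0 +i* a)).
    by rewrite -[LHS]/(sigmaL h _) linearZ.
  rewrite !['i *: (_ - _)]scalerBr scalerA.
  have -> : 'i * h%:C = 0 +i* h :> R[i].
    by apply/eqP; rewrite eq_complex /= !mul0r !mul1r subr0 add0r !eqxx.
  by rewrite opprB subrKA subrK.
apply: le_trans (orbit_distD _ _) _; rewrite orbit_dist_shift addr0.
apply: le_trans (orbit_dist_rnorm _) _.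
apply: le_trans (rnormD _ _) _; rewrite rnormN rnorm_scale rnorm_i normr1 mul1r.
have := E1 hd; have := E2 hd.
rewrite -normrX ger0_norm ?sqr_ge0//; lra.
Qed.

End OrbitMean.

(** * KMS states *)

(** At [t = - u / (c + 1)] the expression equals [- u ^+ 2 / (c + 1) ^+ 2]. *)
Lemma linear_quadratic_ge0 (R : realType) (u c : R) :
  0 <= c -> (forall t : R, 0 <= t * u + t ^+ 2 * c) -> u = 0.
Proof.
move=> c0 h; have c1 : 0 < c + 1 by lra.
have := h (- u / (c + 1)); rewrite (_ : _ + _ = - u ^+ 2 / (c + 1) ^+ 2); last first.
  by field; rewrite gt_eqF.
rewrite pmulr_lge0 ?invr_gt0 ?exprn_gt0// oppr_ge0 exprn_even_le0//=.
by move=> /eqP.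
Qed.

(** Real [z] yield [a + b = 0] and purely imaginary [z] yield [a - b = 0]: imaginary parts vanish by
    the order on [R[i]], and real parts by [linear_quadratic_ge0]. *)
Lemma sesquilinear_ge0 (R : realType) (a b c : R[i]) : 0 <= c ->
  (forall z : R[i], 0 <= z * a + z^*%C * b + (z^*%C * z) * c) -> a = 0.
Proof.
case: a => a1 a2; case: b => b1 b2; case: c => c1 c2.
rewrite lecE /= => /andP[/eqP -> c0] h.
have re (t : R) : 0 <= t * (a1 + b1) + t ^+ 2 * c1 /\ 0 = t * (a2 + b2).
  by have := h t%:C; rewrite lecE /= => /andP[/eqP]; lra.
have im (t : R) : 0 <= t * (b2 - a2) + t ^+ 2 * c1 /\ 0 = t * (a1 - b1).
  by have := h (0 +i* t); rewrite lecE /= => /andP[/eqP]; lra.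
have := linear_quadratic_ge0 c0 (fun t => (re t).1).
have := linear_quadratic_ge0 c0 (fun t => (im t).1).
have := (re 1).2; have := (im 1).2 => e1 e2 e3 e4.
by apply/eqP; rewrite eq_complex /=; apply/andP; split; apply/eqP; lra.
Qed.

(** * States: boundedness and null vectors *)

Section StateFacts.
Variables (R : realType) (A : normedStarAlgType R) (phi : A -> R[i]).
Hypothesis phi_state : is_state phi.
Implicit Types (x y w : A) (a z : R[i]).

Lemma stateD x y : phi (x + y) = phi x + phi y.
Proof. by case: phi_state => phil _ _; have := phil 1 x y; rewrite !scale1r. Qed.

Lemma stateZ a x : phi (a *: x) = a * phi x.
Proof.
case: phi_state => phil _ _; have phi0 : phi 0 = 0.
  by apply: (addrI (phi 0)); rewrite -stateD !addr0.
by have := phil a x 0; rewrite !addr0 phi0 addr0.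
Qed.

Lemma stateB x y : phi (x - y) = phi x - phi y.
Proof. by rewrite -scaleN1r stateD stateZ mulN1r. Qed.

Lemma state0 : phi 0 = 0.
Proof. by rewrite -(subrr (0 : A)) stateB subrr. Qed.

Lemma state_sum (I : Type) (s : seq I) (f : I -> A) :
  phi (\sum_(i <- s) f i) = \sum_(i <- s) phi (f i).
Proof. exact: (big_morph phi stateD state0). Qed.

Lemma state_bound x : rnorm (phi x) <= rnorm x.
Proof.
case: phi_state => _ _ phi1.
have hs : has_sup [set rnorm (phi x) | x in [set x : A | rnorm x <= 1]].
  (* A set without supremum has [sup] equal to 0, not 1. *)
  by apply: contrapT => /sup_out; rewrite phi1 => /eqP; rewrite oner_eq0.
have [x0|x0] := eqVneq x 0; first by rewrite x0 state0 !rnorm0.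
have xp : 0 < rnorm x by exact: rnorm_gt0.
have : rnorm (phi (((rnorm x)^-1)%:C *: x)) <= 1.
  rewrite -phi1; apply: ub_le_sup; first by case: hs.
  exists (((rnorm x)^-1)%:C *: x) => //=.
  by rewrite rnorm_scale rnormC gtr0_norm ?invr_gt0// mulVf// gt_eqF.
rewrite stateZ rnormM rnormC gtr0_norm ?invr_gt0// ler_pdivrMl//.
by rewrite mulr1.
Qed.

(** Cauchy-Schwarz for a null vector: positivity at [p + z *: w] for all scalars [z] leaves no room
    for a cross term. *)
Lemma state_null_left (p w : A) : phi (star p ** p) = 0 -> phi (star p ** w) = 0.
Proof.
move=> p0; have pos : forall x, 0 <= phi (star x ** x) by case: phi_state.
apply: (@sesquilinear_ge0 _ _ (phi (star w ** p)) (phi (star w ** w))) => // z.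
have := pos (p + z *: w).
rewrite starD starZ amulDl !amulDr -!amulZl -!amulZr scalerA !stateD !stateZ p0.
by rewrite add0r addrA.
Qed.

End StateFacts.

Section AmulSum.
Variables (R : realType) (A : normedStarAlgType R).
Implicit Types (x y : A).

Lemma amul0 x : x ** 0 = 0.
Proof. by rewrite -{1}[0](scale0r (0 : A)) -amulZr scale0r. Qed.

Lemma amul0l x : 0 ** x = 0.
Proof. by rewrite -{1}[0](scale0r (0 : A)) -amulZl scale0r. Qed.

Lemma amul_suml (I : Type) (s : seq I) (f : I -> A) y :
  (\sum_(i <- s) f i) ** y = \sum_(i <- s) f i ** y.
Proof. by apply: (big_morph (fun x => x ** y)) => [u v|]; rewrite ?amulDl ?amul0l. Qed.

Lemma amul_sumr (I : Type) (s : seq I) (f : I -> A) y :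
  y ** (\sum_(i <- s) f i) = \sum_(i <- s) y ** f i.
Proof. by apply: (big_morph (fun x => y ** x)) => [u v|]; rewrite ?amulDr ?amul0. Qed.

Lemma rnorm_amul x y : rnorm (x ** y) <= rnorm x * rnorm y.
Proof. by rewrite -lecR rmorphM/= -!rnormE norm_amul. Qed.

End AmulSum.

(** * Consequences of the KMS condition *)

Section KMSState.
Variables (R : realType) (A : normedStarAlgType R) (sigma : R -> A -> A).
Hypothesis sigma_dyn : is_dynamics sigma.
Hypothesis sigma_contr : forall t x, rnorm (sigma t x) <= rnorm x.
Variables (beta : R) (phi : A -> R[i]).
Hypothesis phi_KMS : is_KMS sigma beta phi.

Let phi_state : is_state phi. Proof. by case: phi_KMS. Qed.
Let sigma_linear t : linear (sigma t).
Proof. by case: sigma_dyn => h _ _ _; case: (h t). Qed.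
Let sigma0 x : sigma 0 x = x. Proof. by case: sigma_dyn. Qed.
Let sigmaD s t x : sigma (s + t) x = sigma s (sigma t x). Proof. by case: sigma_dyn. Qed.

(** Extends identities from analytic elements to the whole algebra, both sides being bounded and
    additive in [x]. *)
Lemma state_eq_dense (D : set A) (f g : A -> A) (M : R) : dense D ->
  {morph f : x y / x - y} -> {morph g : x y / x - y} ->
  (forall x, rnorm (f x) <= M * rnorm x) -> (forall x, rnorm (g x) <= M * rnorm x) ->
  (forall x, D x -> phi (f x) = phi (g x)) -> forall x, phi (f x) = phi (g x).
Proof.
move=> Dd fB gB fM gM fg x; apply/eqP; rewrite -subr_eq0; apply/eqP.
apply: rnorm_eq0_eps => e e0.
have M1 : 0 < `|M| + 1 by rewrite ltr_pwDr.
have e1 : 0 < e / (2 * (`|M| + 1)) by rewrite divr_gt0// mulr_gt0.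
have [d Dx xd] := dense_rnorm x Dd e1.
have -> : phi (f x) - phi (g x) = phi (f (x - d)) - phi (g (x - d)).
  by rewrite fB gB !(stateB phi_state) (fg d Dx) opprB addrA subrK.
apply: le_trans (rnormD _ _) _; rewrite rnormN.
have h1 := le_trans (state_bound phi_state _) (fM (x - d)).
have h2 := le_trans (state_bound phi_state _) (gM (x - d)).
have h3 : M * rnorm (x - d) <= (`|M| + 1) * rnorm (x - d).
  by rewrite ler_wpM2r ?rnorm_ge0//; have := ler_norm M; lra.
move: xd; rewrite ltr_pdivlMr ?mulr_gt0// => xd; lra.
Qed.

Lemma KMS_fixed_commutes S : (forall t, sigma t S = S) ->
  forall y, phi (S ** y) = phi (y ** S).
Proof.
move=> sS; case: (phi_KMS) => _ [D [Dd Ds Da DK]] _.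
apply: (state_eq_dense (M := rnorm S) Dd).
- by move=> x y; rewrite amulDr amulNr.
- by move=> x y; rewrite amulDl amulNl.
- by move=> x; exact: rnorm_amul.
- by move=> x; rewrite mulrC; exact: rnorm_amul.
move=> y Dy; apply/eqP; rewrite -subr_eq0; apply/eqP/rnorm_eq0_eps => e e0.
have N0 : 0 < rnorm y + 1 by rewrite ltr_wpDl ?rnorm_ge0.
set N := rnorm y + 1 in N0.
have e1 : 0 < e / (3 * N) by rewrite divr_gt0// mulr_gt0.
have [x Dx Sx] := dense_rnorm S Dd e1.
have [F Fext] := Da x Dx.
have F0 := orbit_dist_analytic sigma_linear sigma_contr sigma0 sigmaD beta Fext.
(* One list of times makes the means of [x] and of [F (0 +i* beta)] close to each other; averaging
   also keeps the mean of [x] close to the fixed element [S]. *)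
have [s s0 sF] := orbit_dist_near sigma (F (0 +i* beta) - x) e1.
rewrite F0 add0r orbit_meanB// in sF.
have mS : orbit_mean sigma s S = S.
  rewrite /orbit_mean (eq_bigr (fun=> S)) => [|t _]; last exact: sS.
  rewrite big_const_seq count_predT iter_addr_0 -[S *+ _]scaler_nat scalerA.
  rewrite -(rmorph_nat (real_complex R)) -rmorphM/= mulVf ?scale1r//.
  by rewrite pnatr_eq0 size_eq0.
have Sm : rnorm (S - orbit_mean sigma s x) < e / (3 * N).
  rewrite -{1}mS -orbit_meanB//; apply: le_lt_trans Sx.
  exact: rnorm_orbit_mean.
set m := orbit_mean sigma s x in sF Sm.
set mF := orbit_mean sigma s (F (0 +i* beta)) in sF.
have mid : phi (m ** y) = phi (y ** mF).
  rewrite /m /mF /orbit_mean -amulZl -amulZr !(stateZ phi_state) amul_suml amul_sumr.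
  rewrite !(state_sum phi_state); congr (_ * _); apply: eq_bigr => t _.
  (* The KMS identity is used for [sigma t x], whose extension has the value
     [sigma t (F (0 +i* beta))] at [0 +i* beta]. *)
  rewrite (DK _ _ (fun z => F (z + t%:C)) (Ds t x Dx) Dy).
    by rewrite (analytic_extension_shift sigma_linear sigma_contr sigmaD Fext).
  exact: analytic_extension_orbit.
(* Three errors, each at most [e / 3]: this fixes the tolerance [e / (3 * N)]. *)
have -> : phi (S ** y) - phi (y ** S) =
    phi ((S - m) ** y) + phi (y ** (mF - m)) - phi (y ** (S - m)).
  rewrite !amulDl !amulDr !amulNl !amulNr !(stateB phi_state) mid.
  by rewrite opprB !subrKA.
have le1 (w : A) : rnorm w < e / (3 * N) -> rnorm w * rnorm y <= e / 3.
  move=> wN; apply: (@le_trans _ _ (e / (3 * N) * N)).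
    by rewrite ler_pM ?rnorm_ge0// ?ltW// /N; lra.
  by rewrite invfM mulrA divfK// gt_eqF.
have bnd u v : rnorm (phi (u ** v)) <= rnorm u * rnorm v.
  exact: le_trans (state_bound phi_state _) (rnorm_amul _ _).
have := bnd (S - m) y; have := bnd y (mF - m); have := bnd y (S - m).
have := le1 _ Sm; have := le1 _ sF; rewrite ![rnorm y * _]mulrC => h1 h2 h3 h4 h5.
apply: le_trans (rnormD _ _) _; rewrite rnormN.
have := rnormD (phi ((S - m) ** y)) (phi (y ** (mF - m))); lra.
Qed.

(** Density frees the second argument of the KMS identity from [D], with [x] and [F] kept fixed. *)
Lemma KMS_swap x F w (D : set A) : dense D ->
  (forall x y F, D x -> D y -> analytic_extension sigma x F ->
     phi (x ** y) = phi (y ** F (0 +i* beta))) ->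
  D x -> analytic_extension sigma x F -> phi (x ** w) = phi (w ** F (0 +i* beta)).
Proof.
move=> Dd DK Dx Fext; move: w; set z := F _.
apply: (state_eq_dense (M := rnorm x + rnorm z) Dd).
- by move=> u v; rewrite amulDr amulNr.
- by move=> u v; rewrite amulDl amulNl.
- move=> u; apply: le_trans (rnorm_amul _ _) _.
  by rewrite ler_wpM2r ?rnorm_ge0// lerDl rnorm_ge0.
- move=> u; apply: le_trans (rnorm_amul _ _) _; rewrite mulrC.
  by rewrite ler_wpM2r ?rnorm_ge0// lerDr rnorm_ge0.
by move=> y Dy; exact: DK.
Qed.

Lemma KMS_null_projection p : star p = p -> p ** p = p -> phi p = 0 ->
  forall u v, phi (u ** p ** v) = 0.
Proof.
move=> ps pp p0; case: (phi_KMS) => _ [D [Dd _ Da DK]] _ u v; rewrite -amulA.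
(* Writing 0 as [phi (p ** 0)] gives the goal the shape of [state_eq_dense] in [u], with a constant
   second map. *)
rewrite -(state0 phi_state) -(amul0 p); move: u.
have pw w : phi (p ** w) = 0.
  by rewrite -{1}ps; apply: (state_null_left phi_state); rewrite ps pp.
apply: (@state_eq_dense D (fun u => u ** (p ** v)) (fun=> p ** 0) (rnorm (p ** v))) => //.
- by move=> x y; rewrite amulDl amulNl.
- by move=> x y; rewrite amul0 subrr.
- by move=> x; rewrite mulrC; exact: rnorm_amul.
- by move=> x; rewrite amul0 rnorm0 mulr_ge0 ?rnorm_ge0.
move=> x Dx; have [F Fext] := Da x Dx.
by rewrite (KMS_swap _ Dd DK Dx Fext) -amulA !pw.
Qed.

End KMSState.

(** * Contractivity of star-homomorphisms *)

Lemma Re_abs_le_rnorm (R : realType) (z : R[i]) : `|complex.Re z| <= rnorm z.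
Proof. by rewrite -lecR -rnormE normc_ge_Re. Qed.

Lemma Im_abs_le_rnorm (R : realType) (z : R[i]) : `|complex.Im z| <= rnorm z.
Proof.
by rewrite -lecR -rnormE normc_def lecR -sqrtr_sqr ler_sqrt ?lerDr ?addr_ge0 ?sqr_ge0.
Qed.

(** * Completeness with explicit rates *)

Section Completeness.
Variable R : realType.

Definition cauchy_rate (V : normedZmodType R[i]) (u : nat -> V) (e : nat -> R) : Prop :=
  forall n m, (n <= m)%N -> rnorm (u n - u m) <= e n.

Definition vanishing (e : nat -> R) : Prop :=
  forall eps : R, 0 < eps -> exists N, forall n, (N <= n)%N -> e n < eps.

(** The limit is approached at the given rate [e] itself: for operators, pointwise limits then
    converge in operator norm. *)
Definition rate_complete (V : normedZmodType R[i]) : Prop :=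
  forall (u : nat -> V) (e : nat -> R), cauchy_rate u e -> vanishing e ->
    exists l, forall n, rnorm (u n - l) <= e n.

(** The intervals of centre [a n] and radius [e n] pairwise meet, so the supremum of their lower
    ends lies in all of them. *)
Lemma real_rate_complete (a e : nat -> R) :
  (forall n m, (n <= m)%N -> `|a n - a m| <= e n) ->
  exists l, forall n, `|a n - l| <= e n.
Proof.
move=> ae.
have e0 n : 0 <= e n by exact: le_trans (ae n n (leqnn n)).
have le n m : a n - e n <= a m + e m.
  have [nm|mn] := leqP n m.
    by have := ae _ _ nm; have := e0 m; rewrite ler_norml => ? /andP[]; lra.
  by have := ae _ _ (ltnW mn); have := e0 n; rewrite ler_norml => ? /andP[]; lra.
exists (sup [set a n - e n | n in [set: nat]]) => n.
rewrite ler_norml; apply/andP; split.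
  suff : sup [set a n - e n | n in [set: nat]] <= a n + e n by lra.
  apply: ge_sup; first by exists (a 0%N - e 0%N), 0%N.
  by move=> _ [m _ <-].
suff : a n - e n <= sup [set a n - e n | n in [set: nat]] by lra.
by apply: ub_le_sup; [exists (a 0%N + e 0%N) => _ [m _ <-]|exists n].
Qed.

Lemma complex_rate_limit (z : nat -> R[i]) (e : nat -> R) : cauchy_rate z e ->
  exists l, forall n, rnorm (z n - l) <= 2 * e n.
Proof.
move=> ze.
have [|a aP] := @real_rate_complete (fun n => complex.Re (z n)) e.
  by move=> n m /ze; apply: le_trans; rewrite -raddfB; exact: Re_abs_le_rnorm.
have [|b bP] := @real_rate_complete (fun n => complex.Im (z n)) e.
  by move=> n m /ze; apply: le_trans; rewrite -raddfB; exact: Im_abs_le_rnorm.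
exists (a +i* b) => n.
have -> : z n - (a +i* b) = (complex.Re (z n) - a)%:C + (0 +i* (complex.Im (z n) - b)).
  by apply/eqP; rewrite eq_complex; case: (z n) => x y /=; rewrite addr0 add0r !eqxx.
apply: le_trans (rnormD _ _) _; rewrite rnormC rnorm_i.
by have := aP n; have := bP n; lra.
Qed.

(** Coordinatewise limits exist with the loose rate [2 * e n]. The rate [e n] is recovered on each
    finite set [A] by comparing with [u m] for large [m]. *)
Lemma ell2_rate_complete (I : choiceType) : rate_complete (ell2 R I).
Proof.
move=> u e ue ev.
have e0 n : 0 <= e n by apply: le_trans (ue n n (leqnn n)); exact: rnorm_ge0.
have coord (v : ell2 R I) i : rnorm (v i) <= rnorm v.
  rewrite -ler_sqr ?nnegrE ?rnorm_ge0// rnorm_ell2 sqr_hnorm.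
  exact: coord_le_hnorm2.
have limc i : exists l, forall n, rnorm (u n i - l) <= 2 * e n.
  by apply: complex_rate_limit => n m /ue; apply: le_trans; exact: (coord (u n - u m)).
pose l i := sval (cid (limc i)).
have lP i n : rnorm (u n i - l i) <= 2 * e n := svalP (cid (limc i)) n.
have bnd n A : partial_sum (fun i => rnorm (u n i - l i) ^+ 2) A <= e n ^+ 2.
  apply/ler_addgt0Pr => eps eps0.
  pose k : R := (size A).+1%:R.
  have k0 : 0 < k by rewrite ltr0n.
  have kA : (size A)%:R <= k by rewrite ler_nat.
  have en0 := e0 n.
  (* With [p <= e n] and [e m <= 1 / 2], the square of [p + 2 * e m] exceeds [p ^+ 2] by at most
     [2 * e m * (2 * e n + 1)]; [d] keeps the sum of these excesses over [A] below [eps]. *)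
  pose d : R := Num.min (1 / 2) (eps / (2 * k * (2 * e n + 1))).
  have d0 : 0 < d by rewrite lt_min !divr_gt0// ?mulr_gt0//; lra.
  have [N NP] := ev _ d0.
  pose m := maxn n N; have nm : (n <= m)%N by exact: leq_maxl.
  have := NP m (leq_maxr _ _); rewrite lt_min => /andP[em1].
  rewrite ltr_pdivlMr ?mulr_gt0//; last by lra.
  move=> em2; have em0 := e0 m.
  apply: (@le_trans _ _ (partial_sum (fun i => rnorm ((u n - u m) i) ^+ 2) A +
     \sum_(i <- A) 2 * e m * (2 * e n + 1))).
    rewrite !partial_sumE -big_split/=; apply: ler_sum => i _.
    have h1 : rnorm (u n i - l i) <= rnorm ((u n - u m) i) + 2 * e m.
      rewrite -(subrKA (u m i)); apply: le_trans (rnormD _ _) _.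
      by rewrite lerD2l lP.
    have h2 := le_trans (coord (u n - u m) i) (ue _ _ nm).
    have h3 := rnorm_ge0 ((u n - u m) i).
    have h4 := rnorm_ge0 (u n i - l i).
    set p := rnorm ((u n - u m) i) in h1 h2 h3 *.
    apply: (@le_trans _ _ ((p + 2 * e m) ^+ 2)).
      by rewrite ler_sqr ?nnegrE// addr_ge0// mulr_ge0.
    rewrite sqrrD -addrA lerD2l.
    have := ler_wpM2l em0 h2; have : e m * e m <= e m * (1 / 2) by rewrite ler_wpM2l// ltW.
    by rewrite expr2; lra.
  apply: lerD.
    apply: le_trans (psum_le_hnorm2 _ _) _; rewrite -sqr_hnorm ler_sqr ?nnegrE ?hnorm_ge0//.
    exact: ue.
  rewrite big_const_seq count_predT iter_addr_0 -[X in X <= _]mulr_natr.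
  apply: (@le_trans _ _ (2 * e m * (2 * e n + 1) * k)).
    by rewrite ler_wpM2l// !mulr_ge0//; lra.
  lra.
have vs n : (fun i => u n i - l i) \in @square_summable R I.
  by apply/square_summableP; exists (e n ^+ 2).
(* The limit is square summable as the difference of [u 0%N] and [u 0%N - l]. *)
pose L : ell2 R I := u 0%N - Ell2 (vs 0%N).
have LE i : L i = l i by rewrite -[RHS](subKr (u 0%N i)).
exists L => n; rewrite rnorm_ell2 -ler_sqr ?nnegrE ?hnorm_ge0// sqr_hnorm.
apply: hnorm2_le => A; apply: le_trans (bnd n A).
rewrite !partial_sumE; apply: ler_sum => i _.
by rewrite [(u n - L) i]/(u n i - L i) LE.
Qed.

Lemma bop_rate_complete (I : choiceType) : rate_complete (bop R I).
Proof.
move=> T e Te ev.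
have e0 n : 0 <= e n by apply: le_trans (Te n n (leqnn n)); exact: rnorm_ge0.
have lim u : exists l, forall n, rnorm (T n u - l) <= e n * rnorm u.
  apply: ell2_rate_complete => [n m nm|eps eps0].
    apply: le_trans (opnormP (T n - T m) u) _.
    by rewrite ler_wpM2r ?rnorm_ge0//; exact: Te.
  have u1 : 0 < rnorm u + 1 by rewrite ltr_wpDl ?rnorm_ge0.
  have [N NP] := ev _ (divr_gt0 eps0 u1); exists N => n /NP.
  rewrite ltr_pdivlMr//; apply: le_lt_trans.
  by rewrite ler_wpM2l// lerDl.
pose L u := sval (cid (lim u)).
have LP u n : rnorm (T n u - L u) <= e n * rnorm u := svalP (cid (lim u)) n.
have Lin : L \in @bounded_op R I.
  apply/bounded_opP; split => [a u v|].
    apply/eqP; rewrite -subr_eq0; apply/eqP/rnorm_eq0_eps => eps eps0.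
    (* [k] collects the factors of [e n] in the three errors; the added 1 makes it positive. *)
    pose k := rnorm a * rnorm u + rnorm v + rnorm (a *: u + v) + 1.
    have [ha hu hv huv] : [/\ 0 <= rnorm a, 0 <= rnorm u, 0 <= rnorm v & 0 <= rnorm (a *: u + v)].
      by split; exact: rnorm_ge0.
    have hau := mulr_ge0 ha hu.
    have k0 : 0 < k by rewrite /k; lra.
    have [n nP] := ev _ (divr_gt0 eps0 k0).
    have := nP n (leqnn n); rewrite ltr_pdivlMr// => enk.
    have -> : L (a *: u + v) - (a *: L u + L v) =
        a *: (T n u - L u) + (T n v - L v) - (T n (a *: u + v) - L (a *: u + v)).
      have -> : T n (a *: u + v) = a *: T n u + T n v by rewrite linearP.
      rewrite scalerBr; move: (L _) (a *: T n u) (T n v) (a *: L u) (L v) => p tu tv lu lv.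
      by rewrite addrACA -opprD opprB [RHS]addrC subrKA.
    apply: le_trans (rnormD _ _) _; rewrite rnormN.
    have h1 := rnormD (a *: (T n u - L u)) (T n v - L v).
    have h2 := LP (a *: u + v) n; have h3 := LP v n.
    have h4 : rnorm (a *: (T n u - L u)) <= e n * (rnorm a * rnorm u).
      by rewrite rnorm_scale mulrCA ler_wpM2l.
    apply: le_trans (lerD (le_trans h1 (lerD h4 h3)) h2) _.
    apply: le_trans (ltW enk).
    rewrite -mulrDr -mulrDr.
    apply: ler_wpM2l; first exact: e0.
    by rewrite lerDl.
  exists (opnorm (T 0%N) + e 0%N) => u.
  have h1 := LP u 0%N; have h2 := opnormP (T 0%N) u.
  rewrite -[L u](subrKC (T 0%N u)); apply: le_trans (rnormD _ _) _.
  by rewrite mulrDl rnormB lerD.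
exists (Bop Lin) => n; rewrite rnorm_bop; apply: opnorm_le => // u.
exact: LP.
Qed.

Lemma subalg_rate_complete (A : normedStarAlgType R) (B : unital_star_subalgebra A) :
  rate_complete A -> closed (uss_set B) -> rate_complete (subalg B).
Proof.
move=> Ac Bc u e ue ev.
have [l lP] := Ac (fun n => subalg_val (u n)) e ue ev.
have Bl : uss_set B l.
  apply: closed_rnorm Bc _ => eps eps0; have [N NP] := ev _ eps0.
  exists (subalg_val (u N)); first exact: subalgP.
  by rewrite rnormB; exact: le_lt_trans (lP N) (NP N (leqnn N)).
by exists (Subalg (introT (uss_predP B l) Bl)) => n; exact: lP.
Qed.

End Completeness.

Lemma star_one (R : realType) (A : normedStarAlgType R) : star (aone : A) = aone.
Proof. by rewrite -[LHS]amul1r -[X in _ ** X]starK -starM amul1r starK. Qed.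

(** * Square roots of [aone - h] and contractivity *)

Section SquareRoot.
Variables (R : realType) (A : normedStarAlgType R).
Hypothesis A_complete : rate_complete A.

Definition sqrt_step (h y : A) : A := 2^-1 *: (h + y ** y).

Lemma rnorm_half (x : A) : rnorm ((2^-1 : R[i]) *: x) = rnorm x / 2.
Proof.
have -> : (2^-1 : R[i]) = (2^-1 : R)%:C by rewrite -[2]/(2%:R) fmorphV rmorph_nat.
by rewrite rnorm_scale rnormC ger0_norm ?invr_ge0// mulrC.
Qed.

Lemma rnorm_sqrB (x y : A) (q : R) : rnorm x <= q -> rnorm y <= q ->
  rnorm (x ** x - y ** y) <= 2 * q * rnorm (x - y).
Proof.
move=> xq yq.
have -> : x ** x - y ** y = x ** (x - y) + (x - y) ** y.
  by rewrite amulDr amulDl amulNl amulNr addrA subrK.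
apply: le_trans (rnormD _ _) _.
have h1 := rnorm_amul x (x - y); have h2 := rnorm_amul (x - y) y.
have d0 := rnorm_ge0 (x - y).
have := ler_wpM2r d0 xq; have := ler_wpM2l d0 yq; lra.
Qed.

(* [y |-> (h + y ^ 2) / 2] is a contraction of the ball of radius [|h| < 1];
   its fixed point is [1 - sqrt (1 - h)]. *)
Lemma sqrt_one_sub (h : A) : star h = h -> rnorm h < 1 ->
  exists2 y, star y = y & (aone - y) ** (aone - y) = aone - h.
Proof.
move=> hs h1; pose q := rnorm h; have q0 : 0 <= q by exact: rnorm_ge0.
pose y n := iter n (sqrt_step h) 0.
have yS n : y n.+1 = sqrt_step h (y n) by [].
have yq n : rnorm (y n) <= q.
  elim: n => [|n IH]; first by rewrite /y /= rnorm0.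
  rewrite yS rnorm_half ler_pdivrMr//; apply: le_trans (rnormD _ _) _.
  have := rnorm_amul (y n) (y n).
  have : rnorm (y n) * rnorm (y n) <= q * 1 by rewrite ler_pM ?rnorm_ge0// (le_trans IH)// ltW.
  rewrite -/q; lra.
have ys n : star (y n) = y n.
  elim: n => [|n IH]; first exact: star0.
  rewrite yS /sqrt_step starZ starD starM IH hs; congr (_ *: _).
  by rewrite -[2]/(2%:R) fmorphV rmorph_nat.
have stepB x z : rnorm x <= q -> rnorm z <= q ->
    rnorm (sqrt_step h x - sqrt_step h z) <= q * rnorm (x - z).
  move=> xq zq; have -> : sqrt_step h x - sqrt_step h z = 2^-1 *: (x ** x - z ** z).
    by rewrite /sqrt_step -scalerBr opprD addrACA subrr add0r.
  rewrite rnorm_half ler_pdivrMr//.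
  by apply: le_trans (rnorm_sqrB xq zq) _; rewrite [2 * q]mulrC mulrAC.
have yd n : rnorm (y n - y n.+1) <= q ^+ n.
  elim: n => [|n IH]; last first.
    rewrite exprS; apply: le_trans (stepB _ _ (yq n) (yq n.+1)) _.
    by rewrite ler_wpM2l.
  by rewrite expr0 {1}/y /= sub0r rnormN; apply: le_trans (yq 1%N) _; exact: ltW.
have q1 : 0 < 1 - q by rewrite subr_gt0.
(* The geometric tail from rank [n], which bounds the sum of the remaining increments. *)
pose e n := q ^+ n / (1 - q).
have ev : vanishing e.
  move=> eps eps0.
  have /cvgrPdist_lt /(_ _ (mulr_gt0 eps0 q1)) [N _ NP] : GRing.exp q @ \oo --> (0 : R).
    by apply: cvg_expr; rewrite ger0_norm.
  exists N => n /NP /=; rewrite sub0r normrN ger0_norm ?exprn_ge0// => h2.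
  by rewrite /e ltr_pdivrMr.
have [|l lP] := A_complete (u := y) (e := e) _ ev.
  move=> n m /subnKC <-; move: (m - n)%N => k.
  suff : rnorm (y n - y (n + k)%N) <= (q ^+ n - q ^+ (n + k)) / (1 - q).
    move/le_trans; apply; rewrite /e ler_pM2r ?invr_gt0// lerBlDr lerDl.
    by rewrite exprn_ge0.
  elim: k => [|k IH]; first by rewrite addn0 !subrr rnorm0 mul0r.
  rewrite -(subrKA (y (n + k)%N)) addnS; apply: le_trans (rnormD _ _) _.
  apply: le_trans (lerD IH (yd _)) _.
  rewrite ler_pdivlMr// mulrDl divfK ?gt_eqF// exprS; lra.
have lq : rnorm l <= q.
  apply/ler_addgt0Pr => eps /ev[N /(_ N (leqnn N)) eN].
  rewrite -[l](subrKC (y N)); apply: le_trans (rnormD _ _) _.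
  by rewrite rnormB; have := lP N; have := yq N; lra.
have lfix : sqrt_step h l = l.
  apply/eqP; rewrite -subr_eq0; apply/eqP/rnorm_eq0_eps => eps eps0.
  have e20 : 0 < eps / 2 by rewrite divr_gt0.
  have [N NP] := ev _ e20.
  rewrite -(subrKA (y N.+1)); apply: le_trans (rnormD _ _) _.
  rewrite {1}yS; have := stepB _ _ lq (yq N); rewrite [rnorm (l - _)]rnormB.
  have := NP N (leqnn N); have := NP N.+1 (leqW (leqnn N)).
  have := lP N; have := lP N.+1.
  have : q * rnorm (y N - l) <= 1 * rnorm (y N - l) by rewrite ler_wpM2r ?rnorm_ge0// ltW.
  lra.
exists l.
  apply/eqP; rewrite -subr_eq0; apply/eqP/rnorm_eq0_eps => eps eps0.
  have e20 : 0 < eps / 2 by rewrite divr_gt0.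
  have [N NP] := ev _ e20.
  rewrite -(subrKA (y N)) -{1}(ys N) -starN -starD; apply: le_trans (rnormD _ _) _.
  rewrite {1}/rnorm norm_star -/(rnorm _) rnormB.
  by have := NP N (leqnn N); have := lP N; lra.
have half2 : (2^-1 + 2^-1 : R[i]) = 1.
  by rewrite -mulr2n -[_ *+ 2]mulr_natl mulfV ?pnatr_eq0.
(* The fixed-point equation, doubled, is the expanded form of the square root identity. *)
have hl : l + l = h + l ** l.
  by rewrite -{1 2}lfix /sqrt_step -scalerDl half2 scale1r.
rewrite amulDr amul1r amulNr amulDl amul1l amulNl.
have -> : l ** l = l + l - h by rewrite hl addrAC subrr add0r.
by rewrite opprB [l + l - h - l]addrAC addrK subrKA.
Qed.

(** For [rnorm x < 1] there is a self-adjoint [y] such that [aone - y] squares to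
    [aone - star x ** x]. Applying [f], the difference of the squared norms of [u] and [f x u] is
    the squared norm of [f (aone - y) u]. Scaling gives the general case. *)
Lemma star_hom_contractive (I : choiceType) (f : A -> bop R I) :
  linear f -> {morph f : x y / x ** y} -> {morph f : x / star x} -> f aone = aone ->
  forall x, rnorm (f x) <= rnorm x.
Proof.
move=> fl fM fs f1.
have fB x y : f (x - y) = f x - f y.
  by rewrite [x - y]addrC -[- y]scaleN1r fl scaleN1r [RHS]addrC.
have unit_ball x : rnorm x < 1 -> rnorm (f x) <= 1.
  move=> x1; have xx1 : rnorm (star x ** x) < 1.
    apply: le_lt_trans (rnorm_amul _ _) _; rewrite {1}/rnorm norm_star -/(rnorm _).
    apply: (@le_lt_trans _ _ (1 * rnorm x)); last by rewrite mul1r.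
    by rewrite ler_wpM2r ?rnorm_ge0// ltW.
  have [|y ys y2] := sqrt_one_sub _ xx1; first by rewrite starM starK.
  rewrite rnorm_bop; apply: opnorm_le => // u; rewrite mul1r !rnorm_ell2.
  set w := f (aone - y).
  have ws : adjoint w = w by rewrite -[adjoint w]/(star w) /w -fs starD starN ys star_one.
  rewrite -ler_sqr ?nnegrE ?hnorm_ge0//.
  have e1 : inner (f x u) (f x u) = inner u (f (star x ** x) u).
    by rewrite adjointP fM fs.
  have e2 : inner (w u) (w u) = inner u u - inner u (f (star x ** x) u).
    rewrite adjointP ws -innerNr -innerDr; congr inner.
    have -> : w (w u) = (w ** w) u by [].
    by rewrite /w -fM y2 fB f1.
  by rewrite -lecR -!inner_hnorm e1 -subr_ge0 -e2 inner_hnorm ler0c sqr_ge0.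
move=> x; apply/ler_addgt0Pr => eps eps0.
pose c := rnorm x + eps; have c0 : 0 < c by rewrite ltr_wpDl ?rnorm_ge0.
have := unit_ball (c^-1%:C *: x); rewrite rnorm_scale rnormC gtr0_norm ?invr_gt0//.
rewrite ltr_pdivrMl// mulr1 ltrDl => /(_ eps0).
have -> : f (c^-1%:C *: x) = c^-1%:C *: f x.
  by have := fl (c^-1%:C) x 0; rewrite addr0 -(subrr (0 : A)) fB subrr addr0.
by rewrite rnorm_scale rnormC gtr0_norm ?invr_gt0// ler_pdivrMl// mulr1.
Qed.

End SquareRoot.

(** * The Toeplitz algebra *)

Section ToeplitzFacts.
Variable R : realType.

(** Moving the adjoint across the inner product, the coordinate at [k] becomes that of the shifted
    vector at [ax_mul g k], which is [u k]. *)
Lemma toeplitz_isometry (g : axN) : star (toeplitz_gen R g) ** toeplitz_gen R g = aone.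
Proof.
apply: subalg_inj; apply: bopE => u; apply: ell2E => k.
have -> : subalg_val (star (toeplitz_gen R g) ** toeplitz_gen R g) =
  bop_comp (adjoint (toeplitz_op R g)) (toeplitz_op R g) by [].
have : inner (Defs.basis R k) (adjoint (toeplitz_op R g) (toeplitz_op R g u)) = (u k)^*%C.
  rewrite -adjointP toeplitz_op_basis inner_basisl shiftE shift_funE//.
  exact: ax_mul_inj.
by rewrite inner_basisl => /(congr1 conjc); rewrite !conjcK.
Qed.

Lemma toeplitz_rate_complete : rate_complete (toeplitz R).
Proof.
apply: subalg_rate_complete; first exact: bop_rate_complete.
by apply: closed_bigI => B [[_ ?] _].
Qed.

Lemma toeplitz_automorphism_contractive (f : toeplitz R -> toeplitz R) :
  star_automorphism f -> forall x, rnorm (f x) <= rnorm x.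
Proof.
move=> [fl fM fs fb] x.
apply: (star_hom_contractive toeplitz_rate_complete (f := fun x => subalg_val (f x))).
- by move=> a u v; rewrite fl.
- by move=> u v; rewrite fM.
- by move=> u; rewrite fs.
(* Surjectivity forces the unit to be preserved: the product of [f aone] and [f (g aone)] equals
   both [f aone] and [f (g aone)]. *)
case: fb => g _ gK; have -> : f aone = aone; last by [].
by rewrite -[LHS]amul1r -{2}(gK aone) -fM amul1l gK.
Qed.

End ToeplitzFacts.

(** The norm of [psi] is at most 1 because every preimage of [q] bounds [psi q], and at least 1
    because the quotient map carries the unit ball into the unit ball. *)
Lemma state_vanishing_factors (R : realType) (A : normedStarAlgType R)
    (J : closed_star_ideal A) (phi : A -> R[i]) :
  is_state phi -> (forall x, csi_set J x -> phi x = 0) ->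
  exists psi : quotalg J -> R[i], is_state psi /\ forall x, phi x = psi (qpi J x).
Proof.
move=> phi_state phiJ; pose psi (q : quotalg J) := phi (repr q).
have psiE x : phi x = psi (qpi J x).
  apply/eqP; rewrite -subr_eq0 -(stateB phi_state); apply/eqP/phiJ/qpi_eqP.
  by rewrite qpi_repr.
exists psi; split => //; case: (phi_state) => phil pos phi1; split.
- move=> a p q; have [x <-] := qpi_surj p; have [y <-] := qpi_surj q.
  by rewrite -qpiZ -qpiD -!psiE phil.
- move=> q; have [x <-] := qpi_surj q.
  by rewrite -qpi_star -qpiM -psiE pos.
have psi_le q : rnorm (psi q) <= rnorm q.
  rewrite -[X in _ <= X]mul1r; apply: le_qnorm => // x <-.
  by rewrite -psiE mul1r state_bound.
apply/eqP; rewrite eq_le; apply/andP; split.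
  apply: ge_sup; first by exists (rnorm (psi 0)), 0 => //=; rewrite rnorm0.
  by move=> _ [q /= q1 <-]; exact: le_trans (psi_le q) q1.
rewrite -[X in X <= _]phi1; apply: sup_le.
- move=> _ [x /= x1 <-]; apply: le_down; exists (qpi J x); last by rewrite -psiE.
  exact: le_trans (qnorm_le J x) x1.
- by exists (rnorm (phi 0)), 0 => //=; rewrite rnorm0.
split; first by exists (rnorm (psi 0)), 0 => //=; rewrite rnorm0.
by exists 1 => _ [q /= q1 <-]; exact: le_trans (psi_le q) q1.
Qed.

Theorem proposition7p1 (R : realType) (sigma : R -> toeplitz R -> toeplitz R)
    (sigma_dyn : is_dynamics sigma)
    (sigma_S : forall t : R, sigma t (genS R) = genS R)
    (sigma_V : forall (t : R) (a : Nx),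
      sigma t (genV R a) = natpow_i (val a) t *: genV R a)
    (beta : R) (phi : toeplitz R -> R[i]) :
  is_KMS sigma beta phi ->
  exists psi : add_boundary R -> R[i],
    is_state psi /\ forall x, phi x = psi (add_boundary_map x).
Proof.
move=> phi_KMS; have phi_state : is_state phi by case: phi_KMS.
have sigma_contr t x : rnorm (sigma t x) <= rnorm x.
  by case: sigma_dyn => aut _ _ _; exact: toeplitz_automorphism_contractive.
have SS : star (genS R) ** genS R = aone by exact: toeplitz_isometry.
(* Commuting [genS] past its adjoint under [phi] turns the range projection into [aone]. *)
have phiP : phi (add_relation R) = 0.
  rewrite /add_relation (stateB phi_state).
  by rewrite (KMS_fixed_commutes sigma_dyn sigma_contr phi_KMS sigma_S) SS subrr.
have PP : add_relation R ** add_relation R = add_relation R.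
  rewrite /add_relation amulDr amul1r amulNr amulDl amul1l amulNl.
  by rewrite amulA -[genS R ** _ ** genS R]amulA SS amul1r subrr subr0.
have Ps : star (add_relation R) = add_relation R by exact: add_relation_star.
have phiuPv := KMS_null_projection phi_KMS Ps PP phiP.
apply: (state_vanishing_factors phi_state) => x Jx.
(* The vanishing is strengthened to all [u ** x ** v]: this property of [x] defines a closed
   two-sided ideal, so by minimality it need only be checked at the generator. *)
suff null : forall u v, phi (u ** x ** v) = 0 by rewrite -[x]amul1l -[X in phi X]amul1r null.
move: x Jx; apply: smallest_sub; last by move=> _ -> u v; exact: phiuPv.
split; last first.
  apply: closed_from_rnorm => x near u v; apply: rnorm_eq0_eps => e e0.
  have M0 : 0 < rnorm u * rnorm v + 1 by rewrite ltr_wpDl ?mulr_ge0 ?rnorm_ge0.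
  have [y y0 xy] := near _ (divr_gt0 e0 M0).
  have -> : phi (u ** x ** v) = phi (u ** (x - y) ** v).
    by rewrite amulDr amulDl amulNr amulNl (stateB phi_state) y0 subr0.
  apply: le_trans (state_bound phi_state _) _; apply: le_trans (rnorm_amul _ _) _.
  move: xy; rewrite ltr_pdivlMr// => xy; apply: le_trans (ltW xy).
  have h1 := ler_wpM2r (rnorm_ge0 v) (rnorm_amul u (x - y)).
  apply: le_trans h1 _; rewrite mulrC mulrA [rnorm v * _]mulrC mulrC.
  by rewrite ler_wpM2l ?rnorm_ge0// lerDl.
split=> [u v|x y x0 y0 u v|a x x0 u v|w x x0 u v|x w x0 u v].
- by rewrite amul0 amul0l (state0 phi_state).
- by rewrite amulDr amulDl (stateD phi_state) x0 y0 addr0.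
- by rewrite -amulZr -amulZl (stateZ phi_state) x0 mulr0.
- by rewrite amulA x0.
- by rewrite amulA -amulA x0.
Qed.
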